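(* For every integer $n\ge1$, the zeta function $\zeta_{\mathbb{S}^n}(s,\lambda_n)$ satisfies, as an identity of meromorphic functions of $s\in\mathbb{C}$, the two-term recursion $$\zeta_{\mathbb{S}^{n+2}}(s,\lambda_{n+2})=\frac{\zeta_{\mathbb{S}^n}(s-1,\lambda_n)-\left(\frac{n-1}{2}\right)^2\zeta_{\mathbb{S}^n}(s,\lambda_n)}{n(n+1)}-\left(\frac{2}{n+1}\right)^{2s},$$ with initial conditions $$\zeta_{\mathbb{S}^1}(s,\lambda_1)=2\zeta(2s),\qquad \zeta_{\mathbb{S}^2}(s,\lambda_2)=(4^s-2)\zeta(2s-1)-4^s.$$
   Context: $\zeta(s)$ is the Riemann zeta function. For $n\ge1$ let $m_k^n=(2k+n-1)\frac{(k+n-2)!}{k!\,(n-1)!}$ for $k\ge1$ (the multiplicity of the eigenvalue $k(k+n-1)$ of the Laplacian on the unit sphere $\mathbb{S}^n$) and $\lambda_n=\left(\frac{n-1}{2}\right)^2$. The shifted zeta function is $\zeta_{\mathbb{S}^n}(s,\lambda_n):=\sum_{k=1}^\infty m_k^n\left(k+\frac{n-1}{2}\right)^{-2s}$ for $\mathrm{Re}(s)$ large, extended meromorphically to $\mathbb{C}$. *)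

(* Defs.v *)
From Stdlib Require Import Reals Factorial ClassicalEpsilon.
From Coquelicot Require Import Coquelicot.

Local Open Scope C_scope.

(** [x ^ s = exp (s * ln x)] for a real base; only used for [0 < x]. *)
Definition cpow (x : R) (s : C) : C :=
  (exp (Re s * ln x) * cos (Im s * ln x),
   exp (Re s * ln x) * sin (Im s * ln x))%R.

(** Meromorphic functions are represented by total functions [C -> C] whose
    values at isolated points (in particular at poles) carry no information:
    near [z0], off [z0], the function has a convergent Laurent expansion with
    finite principal part,
    [f z = (z - z0) ^ (-N) * (sum over i of a i * (z - z0) ^ i)]. *)
Definition meromorphic_at (f : C -> C) (z0 : C) : Prop :=
  exists (N : nat) (a : nat -> C),
    @locally' C_UniformSpace z0 (fun z =>
      @is_pseries C_AbsRing C_NormedModule a (z - z0) ((z - z0) ^ N * f z)).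

Definition meromorphic (f : C -> C) : Prop := forall z0 : C, meromorphic_at f z0.

(** Equality of meromorphic functions: agreement on a punctured neighbourhood
    of every point of the plane, hence outside a closed discrete set. *)
Definition meromorphic_eq (f g : C -> C) : Prop :=
  forall z0 : C, @locally' C_UniformSpace z0 (fun z => f z = g z).

(** [F] is meromorphic on the whole plane and is the sum of the series
    [u 1 s + u 2 s + ...] for [Re s] large. *)
Definition is_continuation (u : nat -> C -> C) (F : C -> C) : Prop :=
  meromorphic F /\
  exists sigma : R, forall s : C, (sigma < Re s)%R ->
    @is_series C_AbsRing C_NormedModule (fun k => u (S k) s) (F s).

(** By the identity theorem the continuation is unique up to
    [meromorphic_eq], so the representative chosen is immaterial. *)
Definition continuation (u : nat -> C -> C) : C -> C :=
  epsilon (inhabits (fun _ : C => RtoC 0)) (is_continuation u).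

Definition riemann_zeta : C -> C :=
  continuation (fun k s => cpow (INR k) (- s)).

(** The natural subtractions are exact for [1 <= n] and [1 <= k]. *)
Definition sphere_mult (n k : nat) : R :=
  ((2 * INR k + INR n - 1) * INR (fact (k + n - 2))
     / (INR (fact k) * INR (fact (n - 1))))%R.

(** The zeta function of the [n]-sphere with shift [((n - 1) / 2) ^ 2]:
    [k (k + n - 1) + ((n - 1) / 2) ^ 2 = (k + (n - 1) / 2) ^ 2]. *)
Definition sphere_zeta (n : nat) : C -> C :=
  continuation (fun k s =>
    RtoC (sphere_mult n k) * cpow (INR k + (INR n - 1) / 2) (- (2 * s))).

(* Main.v *)
(** [zeta s] is continued by summing [n^(1-s) - (n+1)^(1-s)] over [n >= 2]
    after a binomial expansion: with [Z s = zeta s - 1],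
    [(s - 1) Z s = 2^(1-s) + sum over 2 <= j <= J of binom(1-s, j) Z (s + j - 1)
    + remainder], where the remainder converges normally for [Re s > 2 - J];
    this extends [Z] one unit strip at a time to the left.  The sphere zeta
    functions then satisfy the claimed relations termwise where the series
    converge, because [y^2 - ((n-1)/2)^2 = (k+1)(k+n)] for
    [y = k + (n+1)/2], and the identity theorem does the rest. *)

Require Import Defs.
From Stdlib Require Import ZArith Reals Lra Lia Classical ClassicalEpsilon.
From Coquelicot Require Import Coquelicot.

Local Open Scope C_scope.

(** * Series of complex numbers and normed expansions *)


(** The sum starts at n = 2 because the step from n to n + 1 expands (1 + 1/n)^(1-s): for n >= 2 the
    parameter 1/n is at most 1/2, whereas n = 1 would sit on the circle of convergence. In that
    expansion the j = 0 term cancels n^(1-s) and the j = 1 term is (1-s) n^(-s), whence the factor s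
    - 1; the other shifts j - 1 are at least 1, which gives the width of the strips.
    [meromorphic_at] speaks of local power series, so normally convergent series of functions must
    be shown to have such expansions; coefficient bounds accompany every function for this purpose.
    Values at isolated points are arbitrary, so functions agree only on punctured neighbourhoods,
    and gluing infinitely many partial continuations needs local finiteness. [continuation] is an
    epsilon choice, meaningful only once some continuation is exhibited. For spheres the right-hand
    side of the recursion is exhibited, so that one argument gives both the existence of the
    continuation and the identity. *)

Lemma choice {A B : Type} (R : A -> B -> Prop) :
  (forall x, exists y, R x y) -> exists f : A -> B, forall x, R x (f x).
Proof.
  intros H. exists (fun x => proj1_sig (constructive_indefinite_description _ (H x))).
  intros x. apply proj2_sig.
Qed.

Notation Cseries := (@is_series C_AbsRing C_NormedModule).

Lemma Cseries_ext (u v : nat -> C) (l : C) :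
  (forall n, u n = v n) -> Cseries u l -> Cseries v l.
Proof. exact (is_series_ext u v l). Qed.

Lemma Cseries_plus (u v : nat -> C) (l m : C) :
  Cseries u l -> Cseries v m -> Cseries (fun n => u n + v n) (l + m).
Proof. exact (is_series_plus u v l m). Qed.

Lemma Cseries_scal (c : C) (u : nat -> C) (l : C) :
  Cseries u l -> Cseries (fun n => c * u n) (c * l).
Proof. exact (is_series_scal c u l). Qed.

Lemma Cseries_minus (u v : nat -> C) (l m : C) :
  Cseries u l -> Cseries v m -> Cseries (fun n => u n - v n) (l - m).
Proof. exact (is_series_minus u v l m). Qed.

Lemma Cseries_unique (u : nat -> C) (l m : C) :
  Cseries u l -> Cseries u m -> l = m.
Proof.
  intros Hl Hm.
  exact (@filterlim_locally_unique nat C_AbsRing C_NormedModule eventually _ _ l m Hl Hm).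
Qed.

Lemma Cseries_eq (u : nat -> C) (l m : C) : l = m -> Cseries u l -> Cseries u m.
Proof. now intros ->. Qed.

Lemma Cseries_tail (u : nat -> C) (l : C) :
  Cseries u l -> Cseries (fun n => u (S n)) (l - u 0%nat).
Proof.
  intros H; apply (is_series_incr_1 u).
  refine (Cseries_eq _ _ _ _ H). change (l = (l - u 0%nat) + u 0%nat); ring.
Qed.

Lemma Cseries_untail (u : nat -> C) (l : C) :
  Cseries (fun n => u (S n)) l -> Cseries u (u 0%nat + l).
Proof.
  intros H; apply (is_series_decr_1 u).
  refine (Cseries_eq _ _ _ _ H). change (l = (u 0%nat + l) - u 0%nat); ring.
Qed.

Lemma Cseries_Cmod_le (u : nat -> C) (b : nat -> R) (l : C) (L : R) :
  (forall n, Cmod (u n) <= b n)%R -> Cseries u l -> is_series b L ->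
  (Cmod l <= L)%R.
Proof.
  intros Hub Hu Hb.
  apply (is_lim_seq_le (fun N => Cmod (sum_n u N)) (sum_n b) (Cmod l) L).
  - intros N; induction N as [|N IH].
    + rewrite !sum_O; apply Hub.
    + rewrite !sum_Sn. eapply Rle_trans; [apply Cmod_triangle |].
      apply Rplus_le_compat; auto.
  - apply (filterlim_comp _ _ _ (sum_n u) Cmod _ (locally l)); [exact Hu |].
    exact (@filterlim_norm C_AbsRing C_NormedModule l).
  - exact Hb.
Qed.

Lemma ex_Cseries (u : nat -> C) (b : nat -> R) :
  (forall n, Cmod (u n) <= b n)%R -> ex_series b -> exists l, Cseries u l.
Proof.
  intros Hub Hb.
  exact (@ex_series_le C_AbsRing C_CompleteNormedModule u b Hub Hb).
Qed.

Lemma Cseries_lim (u : nat -> C) (b : nat -> R) (l : C) :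
  (forall n, Cmod (l - sum_n u n) <= b n)%R -> is_lim_seq b 0%R -> Cseries u l.
Proof.
  intros Hub Hb.
  apply (filterlim_locally (sum_n u) l). intros eps.
  assert (He : (0 < eps)%R) by apply cond_pos.
  apply is_lim_seq_spec in Hb. destruct (Hb eps) as [N HN].
  exists N; intros n Hn. specialize (HN n Hn). rewrite Rminus_0_r in HN.
  apply C_NormedModule_mixin_compat1.
  replace (minus (sum_n u n) l) with (- (l - sum_n u n))
    by (change (- (l - sum_n u n) = sum_n u n - l); ring).
  rewrite Cmod_opp. eapply Rle_lt_trans; [apply Hub |].
  eapply Rle_lt_trans; [apply Rle_abs | exact HN].
Qed.

Lemma Cseries_dist (u : nat -> C) (l : C) :
  Cseries u l -> is_lim_seq (fun n => Cmod (l - sum_n u n)) 0%R.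
Proof.
  intros H. apply is_lim_seq_spec. intros eps.
  (* Balls of [C] are products of intervals: a ball of radius [eps / 2] only gives modulus below
     [sqrt 2 * (eps / 2)], which is still less than [eps]. *)
  assert (He : (0 < eps / 2)%R) by (generalize (cond_pos eps); lra).
  destruct (proj1 (filterlim_locally (sum_n u) l) H (mkposreal _ He)) as [N HN].
  exists N; intros n Hn. specialize (HN n Hn).
  apply C_NormedModule_mixin_compat2 in HN. simpl in HN.
  rewrite Rminus_0_r, Rabs_pos_eq by apply Cmod_ge_0.
  rewrite <- Cmod_opp. replace (- (l - sum_n u n)) with (minus (sum_n u n) l)
    by (change (sum_n u n - l = - (l - sum_n u n)); ring).
  eapply Rlt_trans; [exact HN |].
  assert (sqrt 2 < 2)%R.
  { rewrite <- (sqrt_square 2) at 2 by lra. apply sqrt_lt_1; lra. }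
  generalize (cond_pos eps); nra.
Qed.

(** * Interchange of summation in dominated double series *)

Lemma Cseries_sum_n (a : nat -> nat -> C) (s : nat -> C) (K : nat) :
  (forall k, Cseries (a k) (s k)) ->
  Cseries (fun i => sum_n (fun k => a k i) K) (sum_n s K).
Proof.
  intros H; induction K as [|K IH].
  - rewrite sum_O. eapply Cseries_ext; [| apply (H 0%nat)].
    intros i; now rewrite sum_O.
  - rewrite sum_Sn. eapply Cseries_ext; [| apply (Cseries_plus _ _ _ _ IH (H (S K)))].
    intros i; now rewrite sum_Sn.
Qed.

Lemma Cseries_drop (u : nat -> C) (l : C) (K : nat) :
  Cseries u l -> Cseries (fun k => u (S K + k)%nat) (l - sum_n u K).
Proof.
  intros H; apply (is_series_incr_n u (S K)); [lia |].
  simpl Init.Nat.pred.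
  refine (Cseries_eq _ _ _ _ H). change (l = (l - sum_n u K) + sum_n u K); ring.
Qed.

Lemma is_series_drop (u : nat -> R) (l : R) (K : nat) :
  is_series u l -> is_series (fun k => u (S K + k)%nat) (l - sum_n u K)%R.
Proof.
  intros H; apply (is_series_incr_n u (S K)); [lia |].
  simpl Init.Nat.pred.
  refine (eq_ind l (is_series u) H _ _).
  change (l = (l - sum_n u K) + sum_n u K)%R; ring.
Qed.

Lemma Rseries_scal (c : R) (u : nat -> R) (l : R) :
  is_series u l -> is_series (fun n => c * u n)%R (c * l)%R.
Proof. exact (is_series_scal c u l). Qed.

Lemma sum_n_le_series (u : nat -> R) (l : R) (K : nat) :
  (forall n, 0 <= u n)%R -> is_series u l -> (sum_n u K <= l)%R.
Proof.
  intros Hu H.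
  apply (is_lim_seq_incr_compare (sum_n u)); [exact H |].
  intros n; rewrite sum_Sn. generalize (Hu (S n)). unfold plus; simpl; lra.
Qed.

Lemma term_le_series (u : nat -> R) (l : R) (K : nat) :
  (forall n, 0 <= u n)%R -> is_series u l -> (u K <= l)%R.
Proof.
  intros Hu H. eapply Rle_trans; [| exact (sum_n_le_series u l K Hu H)].
  destruct K as [|K]; [rewrite sum_O; lra |].
  rewrite sum_Sn. unfold plus; simpl.
  assert (0 <= sum_n u K)%R; [| lra].
  induction K as [|K IH]; [rewrite sum_O; auto |].
  rewrite sum_Sn; unfold plus; simpl. generalize (Hu (S K)); lra.
Qed.

Lemma ex_series_bounded (u : nat -> R) (L : R) :
  (forall n, 0 <= u n)%R -> (forall n, sum_n u n <= L)%R ->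
  exists l, (l <= L)%R /\ is_series u l.
Proof.
  intros Hu HL.
  destruct (ex_finite_lim_seq_incr (sum_n u) L) as [l Hl]; [| exact HL |].
  - intros n; rewrite sum_Sn. generalize (Hu (S n)). unfold plus; simpl; lra.
  - exists l; split; [| exact Hl].
    apply (is_lim_seq_le (sum_n u) (fun _ => L) l L HL Hl), is_lim_seq_const.
Qed.

Lemma sum_n_le_R (u v : nat -> R) (n : nat) :
  (forall n, u n <= v n)%R -> (sum_n u n <= sum_n v n)%R.
Proof.
  intros H; induction n as [|n IH]; [rewrite !sum_O; auto |].
  rewrite !sum_Sn. now apply Rplus_le_compat.
Qed.

Lemma is_series_le (u v : nat -> R) (l m : R) :
  (forall n, u n <= v n)%R -> is_series u l -> is_series v m -> (l <= m)%R.
Proof.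
  intros H Hu Hv. apply (is_lim_seq_le (sum_n u) (sum_n v) l m); auto.
  intros n; now apply sum_n_le_R.
Qed.

(** Rows are indexed by [k], columns by [i]. A partial sum of the moduli of the column sums involves
    finitely many columns, so it can be exchanged with the sum over [k] and is then dominated row by
    row by [M]. *)
Lemma double_series_le (a : nat -> nat -> C) (b : nat -> C) (S M : nat -> R) (L : R) :
  (forall i, Cseries (fun k => a k i) (b i)) ->
  (forall k, is_series (fun i => Cmod (a k i)) (S k)) ->
  (forall k, S k <= M k)%R -> is_series M L ->
  exists T, (T <= L)%R /\ is_series (fun i => Cmod (b i)) T.
Proof.
  intros Hb HS HM HL.
  assert (Hle : forall k i, (Cmod (a k i) <= M k)%R).
  { intros k i. eapply Rle_trans; [| apply HM].
    apply (term_le_series (fun i => Cmod (a k i)) (S k) i); [| apply HS].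
    intros n; apply Cmod_ge_0. }
  assert (Hc : forall i, exists c, is_series (fun k => Cmod (a k i)) c).
  { intros i. apply (@ex_series_le R_AbsRing R_CompleteNormedModule _ M); [| now exists L].
    intros k. unfold norm; simpl. unfold abs; simpl.
    rewrite Rabs_pos_eq by apply Cmod_ge_0. apply Hle. }
  apply ex_series_bounded; [intros; apply Cmod_ge_0 |]. intros I.
  destruct (choice _ Hc) as [c Hcc].
  apply Rle_trans with (sum_n c I).
  - induction I as [|I IH].
    + rewrite !sum_O. apply (Cseries_Cmod_le (fun k => a k 0%nat) (fun k => Cmod (a k 0%nat))); auto.
      intros; lra.
    + rewrite !sum_Sn. apply Rplus_le_compat; [exact IH |].
      apply (Cseries_Cmod_le (fun k => a k (Datatypes.S I)) (fun k => Cmod (a k (Datatypes.S I)))); auto.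
      intros; lra.
  - apply (is_series_le (fun k => sum_n (fun i => Cmod (a k i)) I) M); [| | exact HL].
    + intros k. eapply Rle_trans; [| apply HM].
      apply (sum_n_le_series (fun i => Cmod (a k i))); [intros; apply Cmod_ge_0 | apply HS].
    + clear -Hcc. induction I as [|I IH].
      * rewrite sum_O. eapply is_series_ext; [| apply Hcc]. intros k; now rewrite sum_O.
      * rewrite sum_Sn. eapply is_series_ext; [| apply (is_series_plus _ _ _ _ IH (Hcc (Datatypes.S I)))].
        intros k; now rewrite sum_Sn.
Qed.

(** With the rows 0 to K removed, the previous bound applies to the rows that remain: the sum of the
    first row totals misses [t] by at most the tail [L - sum_n M K], which tends to zero. *)
Lemma double_series (a : nat -> nat -> C) (b s : nat -> C) (t : C) (S M : nat -> R) (L : R) :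
  (forall i, Cseries (fun k => a k i) (b i)) ->
  (forall k, is_series (fun i => Cmod (a k i)) (S k)) ->
  (forall k, S k <= M k)%R -> is_series M L ->
  (forall k, Cseries (a k) (s k)) -> Cseries b t -> Cseries s t.
Proof.
  intros Hb HS HM HL Hs Ht.
  apply (Cseries_lim s (fun K => L - sum_n M K)%R).
  - intros K.
    destruct (double_series_le (fun k i => a (Datatypes.S K + k)%nat i)
      (fun i => b i - sum_n (fun k => a k i) K) (fun k => S (Datatypes.S K + k)%nat)
      (fun k => M (Datatypes.S K + k)%nat) (L - sum_n M K)%R) as [T [HT1 HT2]]; auto.
    + intros i. apply (Cseries_drop (fun k => a k i) (b i) K), Hb.
    + now apply is_series_drop.
    + eapply Rle_trans; [| exact HT1].
      apply (Cseries_Cmod_le (fun i => b i - sum_n (fun k => a k i) K)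
        (fun i => Cmod (b i - sum_n (fun k => a k i) K))); [intros; apply Rle_refl | | exact HT2].
      apply Cseries_minus; [exact Ht |]. now apply Cseries_sum_n.
  - replace 0%R with (L - L)%R by ring.
    apply is_lim_seq_minus'; [apply is_lim_seq_const | exact HL].
Qed.

(** The weighted [l^1] norm makes these expansions a Banach algebra, so that
    normal convergence can be checked without Cauchy's formula. *)
Definition expands (f : C -> C) (z0 : C) (r M : R) : Prop :=
  exists a : nat -> C,
    (exists S, (S <= M)%R /\ is_series (fun i => Cmod (a i) * r ^ i)%R S) /\
    forall h, (Cmod h <= r)%R -> Cseries (fun i => a i * h ^ i) (f (z0 + h)).

Lemma expands_ext (f g : C -> C) (z0 : C) (r M : R) :
  (forall h, (Cmod h <= r)%R -> f (z0 + h) = g (z0 + h)) ->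
  expands f z0 r M -> expands g z0 r M.
Proof.
  intros H [a [Ha Hf]]. exists a; split; [exact Ha |].
  intros h Hh. rewrite <- H by exact Hh. now apply Hf.
Qed.

Lemma expands_le (f : C -> C) (z0 : C) (r M M' : R) :
  (M <= M')%R -> expands f z0 r M -> expands f z0 r M'.
Proof.
  intros H [a [[S [HS HS']] Hf]]. exists a; split; [| exact Hf].
  exists S; split; [lra | exact HS'].
Qed.

Lemma expands_pos (f : C -> C) (z0 : C) (r M : R) :
  (0 <= r)%R -> expands f z0 r M -> (0 <= M)%R.
Proof.
  intros Hr [a [[S [HS HS']] _]]. apply Rle_trans with S; [| exact HS].
  assert (Hp : forall n, (0 <= Cmod (a n) * r ^ n)%R).
  { intros n. apply Rmult_le_pos; [apply Cmod_ge_0 | now apply pow_le]. }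
  eapply Rle_trans; [apply (Hp 0%nat) |].
  now apply (term_le_series (fun i => Cmod (a i) * r ^ i)%R).
Qed.

(** Weierstrass's theorem on normal convergence, in the weighted norm: the coefficients can be
    summed column by column because [Cmod (a k i) * r ^ i] is at most [M k]. The condition on [F]
    presupposes convergence, so that [F] may be a sum chosen by epsilon as well as an explicit
    function. *)
Lemma expands_series (f : nat -> C -> C) (F : C -> C) (z0 : C) (r : R) (M : nat -> R) (L : R) :
  (0 < r)%R -> (forall k, expands (f k) z0 r (M k)) -> is_series M L ->
  (forall h, (Cmod h <= r)%R -> (exists l, Cseries (fun k => f k (z0 + h)) l) ->
     Cseries (fun k => f k (z0 + h)) (F (z0 + h))) ->
  expands F z0 r L.
Proof.
  intros Hr Hf HL HF.
  destruct (choice _ Hf) as [a Ha].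
  destruct (choice _ (fun k => proj1 (Ha k))) as [S HS].
  assert (Ha2 := fun k => proj2 (Ha k)). clear Ha Hf.
  assert (Hpos : forall k i, (0 <= Cmod (a k i) * r ^ i)%R).
  { intros k n. apply Rmult_le_pos; [apply Cmod_ge_0 | apply pow_le; lra]. }
  assert (Hle : forall k i, (Cmod (a k i) * r ^ i <= M k)%R).
  { intros k i. eapply Rle_trans; [| apply HS].
    apply (term_le_series (fun i => Cmod (a k i) * r ^ i)%R); [apply Hpos | apply HS]. }
  assert (Hcm : forall (c h : C) i, Cmod (c * h ^ i) = (Cmod c * Cmod h ^ i)%R).
  { intros; now rewrite Cmod_mult, Cmod_pow. }
  assert (Hrr : Cmod r = r) by (rewrite Cmod_R; apply Rabs_pos_eq; lra).
  assert (Hb : forall i, exists b, Cseries (fun k => a k i) b).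
  { intros i. assert (Hri : (0 < r ^ i)%R) by (apply pow_lt; lra).
    apply (ex_Cseries (fun k => a k i) (fun k => M k * / r ^ i)%R).
    - intros k. apply Rmult_le_reg_r with (r ^ i)%R; [exact Hri |].
      eapply Rle_trans; [apply Hle |]. right; field. lra.
    - exists (L * / r ^ i)%R. now apply is_series_scal_r. }
  destruct (choice _ Hb) as [b Hbb].
  assert (Hbh : forall h i, Cseries (fun k => a k i * h ^ i) (b i * h ^ i)).
  { intros h i. apply (Cseries_eq _ (h ^ i * b i)); [ring |].
    apply (Cseries_ext (fun k => h ^ i * a k i)); [intros; ring |].
    apply Cseries_scal, Hbb. }
  (* Taking h = r bounds the norm of the summed coefficients; the value at each h in the disc needs
     its own exchange of sums below. *)
  destruct (double_series_le (fun k i => a k i * RtoC r ^ i) (fun i => b i * RtoC r ^ i) S M L)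
    as [T [HT1 HT2]]; [apply Hbh | | apply HS | exact HL |].
  { intros k. eapply is_series_ext; [| apply HS].
    intros i. simpl. now rewrite Hcm, Hrr. }
  assert (HT3 : is_series (fun i => Cmod (b i) * r ^ i)%R T).
  { eapply is_series_ext; [| exact HT2]. intros i. simpl. now rewrite Hcm, Hrr. }
  exists b; split; [now exists T |].
  intros h Hh.
  assert (Hhr : forall c i, (Cmod (c * h ^ i) <= Cmod c * r ^ i)%R).
  { intros c i. rewrite Hcm. apply Rmult_le_compat_l; [apply Cmod_ge_0 |].
    apply pow_incr; split; [apply Cmod_ge_0 | exact Hh]. }
  destruct (ex_Cseries (fun i => b i * h ^ i) _ (fun i => Hhr (b i) i)) as [t Ht];
    [now exists T |].
  assert (HS' : forall k, exists s, (s <= M k)%R /\ is_series (fun i => Cmod (a k i * h ^ i)) s).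
  { intros k. apply ex_series_bounded; [intros; apply Cmod_ge_0 |]. intros n.
    eapply Rle_trans; [| apply (proj1 (HS k))].
    eapply Rle_trans; [apply (sum_n_le_R _ (fun i => Cmod (a k i) * r ^ i)%R); auto |].
    apply sum_n_le_series; [apply Hpos | apply HS]. }
  destruct (choice _ HS') as [S' HS''].
  assert (Hfin : Cseries (fun k => f k (z0 + h)) t).
  { apply (double_series (fun k i => a k i * h ^ i) (fun i => b i * h ^ i) _ t S' M L); auto.
    - intros k; apply HS''.
    - intros k; apply HS''. }
  rewrite (Cseries_unique (fun k => f k (z0 + h)) (F (z0 + h)) t); [exact Ht | | exact Hfin].
  apply HF; [exact Hh | now exists t].
Qed.

Lemma is_series_0 : is_series (fun _ : nat => 0%R) 0%R.
Proof.
  change (is_lim_seq (sum_n (fun _ : nat => 0%R)) 0%R).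
  apply (is_lim_seq_ext (fun _ => 0%R)); [| apply is_lim_seq_const].
  intros n; rewrite sum_n_const; ring.
Qed.

Lemma Cseries_0 : Cseries (fun _ => RtoC 0) (RtoC 0).
Proof.
  apply (Cseries_lim _ (fun _ => 0%R)); [| apply is_lim_seq_const].
  intros n. replace (sum_n (fun _ => RtoC 0) n) with (RtoC 0).
  - replace (0 - 0) with (RtoC 0) by ring. rewrite Cmod_0; lra.
  - induction n as [|n IH]; [now rewrite sum_O |].
    rewrite sum_Sn, <- IH. change (RtoC 0 = 0 + 0); ring.
Qed.

Lemma is_series_untail (u : nat -> R) (l : R) :
  is_series (fun n => u (S n)) l -> is_series u (u 0%nat + l)%R.
Proof.
  intros H; apply (is_series_decr_1 u).
  refine (eq_ind l (is_series (fun k => u (S k))) H _ _).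
  change (l = (u 0%nat + l) - u 0%nat)%R; ring.
Qed.

Lemma expands_const (c z0 : C) (r : R) : expands (fun _ => c) z0 r (Cmod c).
Proof.
  exists (fun i => match i with O => c | S _ => RtoC 0 end); split.
  - exists (Cmod c); split; [lra |].
    replace (Cmod c) with (Cmod c * r ^ 0 + 0)%R at 1 by (simpl; ring).
    apply (is_series_untail (fun i => Cmod (match i with O => c | S _ => RtoC 0 end) * r ^ i)%R).
    eapply is_series_ext; [| apply is_series_0].
    intros n; simpl. rewrite Cmod_0; ring.
  - intros h _. apply (Cseries_eq _ (c * h ^ 0 + 0)); [simpl; ring |].
    apply (Cseries_untail (fun i => (match i with O => c | S _ => RtoC 0 end) * h ^ i)).
    eapply Cseries_ext; [| apply Cseries_0].
    intros n; simpl; ring.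
Qed.

Lemma expands_plus (f g : C -> C) (z0 : C) (r M N : R) :
  (0 <= r)%R -> expands f z0 r M -> expands g z0 r N ->
  expands (fun s => f s + g s) z0 r (M + N).
Proof.
  intros Hr [a [[S [HS HS']] Hf]] [b [[T [HT HT']] Hg]].
  exists (fun i => a i + b i); split.
  - destruct (ex_series_bounded (fun i => Cmod (a i + b i) * r ^ i)%R (S + T)%R) as [U [HU HU']].
    + intros n; apply Rmult_le_pos; [apply Cmod_ge_0 | now apply pow_le].
    + intros n.
      eapply Rle_trans; [apply (sum_n_le_R _ (fun i => Cmod (a i) * r ^ i + Cmod (b i) * r ^ i)%R) |].
      * intros i. rewrite <- Rmult_plus_distr_r.
        apply Rmult_le_compat_r; [now apply pow_le | apply Cmod_triangle].
      * apply sum_n_le_series; [| apply (is_series_plus _ _ _ _ HS' HT')].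
        intros i; apply Rplus_le_le_0_compat; apply Rmult_le_pos; try apply Cmod_ge_0; now apply pow_le.
    + exists U; split; [lra | exact HU'].
  - intros h Hh. eapply Cseries_ext; [| apply (Cseries_plus _ _ _ _ (Hf h Hh) (Hg h Hh))].
    intros i; simpl; ring.
Qed.

Lemma expands_scal (c : C) (f : C -> C) (z0 : C) (r M : R) :
  expands f z0 r M -> expands (fun s => c * f s) z0 r (Cmod c * M).
Proof.
  intros [a [[S [HS HS']] Hf]]. exists (fun i => c * a i); split.
  - exists (Cmod c * S)%R; split; [apply Rmult_le_compat_l; auto; apply Cmod_ge_0 |].
    eapply is_series_ext; [| apply (Rseries_scal (Cmod c) _ _ HS')].
    intros i; simpl. rewrite Cmod_mult. ring.
  - intros h Hh. eapply Cseries_ext; [| apply (Cseries_scal c _ _ (Hf h Hh))].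
    intros i; simpl; ring.
Qed.

Lemma expands_shift_pow (f : C -> C) (z0 : C) (r M : R) (k : nat) :
  (0 <= r)%R -> expands f z0 r M -> expands (fun s => (s - z0) ^ k * f s) z0 r (r ^ k * M).
Proof.
  intros Hr H; induction k as [|k [a [[S [HS HS']] Hf]]].
  - replace (r ^ 0 * M)%R with M by (simpl; ring).
    eapply expands_ext; [| exact H]. intros h _; simpl; ring.
  - exists (fun i => match i with O => RtoC 0 | Datatypes.S j => a j end); split.
    + exists (0 + r * S)%R; split.
      * simpl. apply (Rmult_le_compat_l r) in HS; [lra | exact Hr].
      * replace (0 + r * S)%R with (Cmod 0 * r ^ 0 + r * S)%R by (rewrite Cmod_0; simpl; ring).
        apply (is_series_untail (fun i => Cmod (match i with O => RtoC 0 | Datatypes.S j => a j end) * r ^ i)%R).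
        eapply is_series_ext; [| apply (Rseries_scal r _ _ HS')].
        intros i; simpl. ring.
    + intros h Hh. apply (Cseries_eq _ (0 * h ^ 0 + h * ((z0 + h - z0) ^ k * f (z0 + h)))).
      { simpl. replace (z0 + h - z0) with h by ring. ring. }
      apply (Cseries_untail (fun i => (match i with O => RtoC 0 | Datatypes.S j => a j end) * h ^ i)).
      eapply Cseries_ext; [| apply (Cseries_scal h _ _ (Hf h Hh))].
      intros i; simpl; ring.
Qed.

(** Expanding only the first factor turns the product into the series of the functions
    [a k * ((s - z0) ^ k * g s)], so normal convergence replaces a Cauchy product. *)
Lemma expands_mult (f g : C -> C) (z0 : C) (r M N : R) :
  (0 < r)%R -> expands f z0 r M -> expands g z0 r N ->
  expands (fun s => f s * g s) z0 r (M * N).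
Proof.
  intros Hr [a [[S [HS HS']] Hf]] Hg.
  assert (HN : (0 <= N)%R) by (eapply expands_pos; [| exact Hg]; lra).
  apply expands_le with (S * N)%R; [now apply Rmult_le_compat_r |].
  apply (expands_series (fun k s => a k * ((s - z0) ^ k * g s)) _ z0 r
    (fun k => Cmod (a k) * r ^ k * N)%R); [exact Hr | | now apply is_series_scal_r |].
  - intros k. rewrite Rmult_assoc. apply expands_scal, expands_shift_pow; [lra | exact Hg].
  - intros h Hh _. apply (Cseries_eq _ (g (z0 + h) * f (z0 + h))); [ring |].
    eapply Cseries_ext; [| apply (Cseries_scal (g (z0 + h)) _ _ (Hf h Hh))].
    intros i; simpl. replace (z0 + h - z0) with h by ring. ring.
Qed.

Lemma expands_id (z0 : C) (r : R) : (0 <= r)%R -> expands (fun s => s) z0 r (Cmod z0 + r).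
Proof.
  intros Hr. eapply expands_ext; [| apply (expands_plus (fun _ => z0) (fun s => (s - z0) ^ 1 * 1))].
  - intros h _; simpl; ring.
  - exact Hr.
  - apply expands_const.
  - replace r with (r ^ 1 * Cmod 1)%R at 2 by (rewrite Cmod_1; ring).
    apply (expands_shift_pow (fun _ => RtoC 1)); [exact Hr | apply expands_const].
Qed.

(** * Exponential and binomial series *)


Definition cexp (z : C) : C := (exp (Re z) * cos (Im z), exp (Re z) * sin (Im z))%R.

Lemma cexp_plus (z w : C) : cexp (z + w) = cexp z * cexp w.
Proof.
  destruct z as [a b], w as [c d]. unfold cexp, Cmult, Cplus, Re, Im; simpl.
  rewrite exp_plus, cos_plus, sin_plus. f_equal; ring.
Qed.

Lemma cexp_0 : cexp 0 = 1.
Proof. unfold cexp, Re, Im; simpl. rewrite exp_0, cos_0, sin_0. unfold RtoC; f_equal; ring. Qed.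

Lemma Cmod_cexp (z : C) : Cmod (cexp z) = exp (Re z).
Proof.
  unfold cexp, Cmod; simpl.
  replace (exp (Re z) * cos (Im z) * (exp (Re z) * cos (Im z) * 1)
    + exp (Re z) * sin (Im z) * (exp (Re z) * sin (Im z) * 1))%R
    with (Rsqr (exp (Re z)))%R.
  - apply sqrt_Rsqr. left; apply exp_pos.
  - generalize (sin2_cos2 (Im z)). unfold Rsqr. intros H.
    transitivity (exp (Re z) * exp (Re z) * (sin (Im z) * sin (Im z) + cos (Im z) * cos (Im z)))%R;
      [rewrite H |]; ring.
Qed.

Lemma cpow_cexp (x : R) (s : C) : cpow x s = cexp (s * ln x).
Proof.
  destruct s as [a b]. unfold cpow, cexp, Re, Im, Cmult, RtoC; simpl.
  f_equal; f_equal; f_equal; ring.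
Qed.

(** [gbinom w e j = w (w - e) ... (w - (j - 1) e) / j!]: exponential
    coefficients for [e = 0], binomial ones for [e = 1]; treating both at once
    makes a single differential equation sum the two series. *)
Fixpoint gbinom (w : C) (e : R) (j : nat) : C :=
  match j with
  | O => 1
  | S j' => gbinom w e j' * (w - RtoC (e * INR j')) * RtoC (/ INR (S j'))
  end.

(** The majorant of [gbinom] obtained by making every sign positive. Since the weighted norm is
    submultiplicative, it bounds that norm as well as the modulus. *)
Fixpoint gbinom_bound (W e : R) (j : nat) : R :=
  match j with
  | O => 1%R
  | S j' => (gbinom_bound W e j' * (W + e * INR j') * / INR (S j'))%R
  end.

Lemma gbinom_bound_pos (W e : R) (j : nat) : (0 < W)%R -> (0 <= e)%R -> (0 < gbinom_bound W e j)%R.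
Proof.
  intros HW He; induction j as [|j IH]; [simpl; lra |].
  cbn [gbinom_bound]. assert (0 <= INR j)%R by apply pos_INR.
  assert (0 < / INR (S j))%R by (apply Rinv_0_lt_compat, lt_0_INR; lia).
  assert (0 < W + e * INR j)%R by nra.
  repeat apply Rmult_lt_0_compat; lra.
Qed.

Lemma expands_gbinom (f : C -> C) (z0 : C) (r W e : R) (j : nat) :
  (0 < r)%R -> (0 <= e)%R -> expands f z0 r W ->
  expands (fun s => gbinom (f s) e j) z0 r (gbinom_bound W e j).
Proof.
  intros Hr He Hf. induction j as [|j IH].
  - apply (expands_le _ _ _ (Cmod 1)); [rewrite Cmod_1; simpl; lra |].
    apply (expands_const (RtoC 1)).
  - cbn [gbinom gbinom_bound].
    assert (Hj : (0 <= INR j)%R) by apply pos_INR.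
    assert (HSj : (0 < / INR (S j))%R) by (apply Rinv_0_lt_compat, lt_0_INR; lia).
    replace (/ INR (S j))%R with (Cmod (RtoC (/ INR (S j)))) at 1
      by (rewrite Cmod_R; apply Rabs_pos_eq; lra).
    replace (e * INR j)%R with (Cmod (- RtoC (e * INR j))) at 1
      by (rewrite Cmod_opp, Cmod_R; apply Rabs_pos_eq; nra).
    apply expands_mult; [exact Hr | | apply expands_const].
    apply expands_mult; [exact Hr | exact IH |].
    apply expands_plus; [lra | exact Hf | apply expands_const].
Qed.

(** The norm bound is applied to the constant function [w] and its expansion is evaluated at h = 1,
    which spares a second induction. *)
Lemma Cmod_gbinom_le (w : C) (W e : R) (j : nat) :
  (Cmod w <= W)%R -> (0 <= e)%R -> (Cmod (gbinom w e j) <= gbinom_bound W e j)%R.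
Proof.
  intros Hw He.
  destruct (expands_gbinom (fun _ => w) 0 1 W e j) as [a [[S [HS HS']] Ha]]; [lra | exact He | |].
  { eapply expands_le; [exact Hw | apply expands_const]. }
  eapply Rle_trans; [| exact HS].
  assert (Ha1 : Cseries (fun i => a i * 1 ^ i) (gbinom w e j)).
  { apply (Ha 1). rewrite Cmod_1; lra. }
  refine (Cseries_Cmod_le _ _ _ _ _ Ha1 HS').
  intros n; rewrite Cmod_mult, Cmod_pow, Cmod_1; lra.
Qed.

Lemma gbinom_bound_ex_series (W e x : R) :
  (0 < W)%R -> (0 <= e)%R -> (0 <= x)%R -> (e * x < 1)%R ->
  ex_series (fun j => gbinom_bound W e j * x ^ j)%R.
Proof.
  intros HW He Hx Hex.
  (* The ratio test requires nonzero terms, so x = 0 is treated apart. *)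
  destruct (Req_dec x 0) as [-> | Hx0].
  { exists (gbinom_bound W e 0 * 0 ^ 0 + 0)%R.
    apply (is_series_untail (fun j => gbinom_bound W e j * 0 ^ j)%R).
    eapply is_series_ext; [| apply is_series_0]. intros n; simpl; ring. }
  assert (Hp := fun j => gbinom_bound_pos W e j HW He).
  eapply ex_series_ext; [| apply (ex_series_DAlembert (fun j => gbinom_bound W e j * x ^ j)%R (e * x)%R Hex)].
  - intros n; simpl. apply Rabs_pos_eq, Rmult_le_pos; [left; apply Hp | apply pow_le; lra].
  - intros n; apply Rgt_not_eq, Rmult_lt_0_compat; [apply Hp | apply pow_lt; lra].
  (* The ratio (W + e j) x / (j + 1), rewritten so that its limit e x is visible. *)
  - apply (is_lim_seq_ext (fun j => e * x + (W - e) * x * / INR (S j))%R).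
    + intros n. cbn [gbinom_bound pow].
      assert (0 < INR (S n))%R by (apply lt_0_INR; lia).
      assert (0 < x ^ n)%R by (apply pow_lt; lra). specialize (Hp n).
      assert (0 <= INR n)%R by apply pos_INR.
      rewrite Rabs_pos_eq.
      * rewrite S_INR in *. field. repeat split; lra.
      * apply Rdiv_le_0_compat; [| nra].
        repeat apply Rmult_le_pos; try lra; [nra |]. left; now apply Rinv_0_lt_compat.
    + replace (Finite (e * x)) with (Finite (e * x + (W - e) * x * 0))%R by (f_equal; ring).
      apply is_lim_seq_plus'; [apply is_lim_seq_const |].
      apply is_lim_seq_mult'; [apply is_lim_seq_const |].
      apply (is_lim_seq_incr_1 (fun n => / INR n)%R).
      apply (is_lim_seq_inv INR p_infty); [apply is_lim_seq_INR | discriminate].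
Qed.

(** The sum f of the series satisfies (1 + e t) f' = w f with f(0) = 1, and L' = 1 / (1 + e t), so f
    times exp(-w L) has derivative zero. The argument runs on real and imaginary parts because the
    derivative theory used is that of real power series. *)
Lemma gbinom_series (w : C) (e x : R) (L : R -> R) :
  (0 <= e)%R -> (0 <= x)%R -> (e * x < 1)%R -> L 0%R = 0%R ->
  (forall t, (0 <= t <= x)%R -> is_derive L t (/ (1 + e * t))%R) ->
  Cseries (fun j => gbinom w e j * RtoC x ^ j) (cexp (w * L x)).
Proof.
  intros He Hx Hex HL0 HL.
  set (A := fun j => Re (gbinom w e j)). set (B := fun j => Im (gbinom w e j)).
  set (a := Re w). set (b := Im w).
  (* Real part of the recurrence (n + 1) c(n+1) = (w - e n) c(n); the imaginary part follows. *)
  assert (HrA : forall n, (INR (S n) * A (S n) = a * A n - b * B n - e * (INR n * A n))%R).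
  { intros n. unfold A, B, a, b. cbn [gbinom].
    assert (0 < INR (S n))%R by (apply lt_0_INR; lia).
    rewrite re_scal_r, re_mult.
    destruct w as [w1 w2]; unfold Re, Im; simpl fst; simpl snd. field. lra. }
  assert (HrB : forall n, (INR (S n) * B (S n) = a * B n + b * A n - e * (INR n * B n))%R).
  { intros n. unfold A, B, a, b. cbn [gbinom].
    assert (0 < INR (S n))%R by (apply lt_0_INR; lia).
    rewrite im_scal_r, im_mult.
    destruct w as [w1 w2]; unfold Re, Im; simpl fst; simpl snd. field. lra. }
  set (W := (Cmod w + 1)%R).
  assert (HW : (0 < W)%R) by (unfold W; generalize (Cmod_ge_0 w); lra).
  assert (HWw : (Cmod w <= W)%R) by (unfold W; lra).
  (* The series still converges at some [rho] beyond [x], so [x] lies strictly inside the disc of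
     convergence and the sums are differentiable up to and including [x]. *)
  assert (Hrho : exists rho, (x < rho)%R /\ (e * rho < 1)%R).
  { exists (x + (1 - e * x) / (2 * (1 + e)))%R. split.
    - assert (0 < (1 - e * x) / (2 * (1 + e)))%R by (apply Rdiv_lt_0_compat; lra). lra.
    - apply Rmult_lt_reg_r with (2 * (1 + e))%R; [lra |].
      replace (e * (x + (1 - e * x) / (2 * (1 + e))) * (2 * (1 + e)))%R
        with (e * x * (2 * (1 + e)) + e * (1 - e * x))%R by (field; lra). nra. }
  destruct Hrho as [rho [Hrho1 Hrho2]].
  assert (HCV : forall u : nat -> R, (forall j, Rabs (u j) <= Cmod (gbinom w e j))%R ->
    Rbar_lt x (CV_radius u)).
  { intros u Hu. apply Rbar_lt_le_trans with rho; [exact Hrho1 |].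
    apply (proj1 (CV_radius_bounded u)).
    destruct (gbinom_bound_ex_series W e rho) as [l Hl]; try lra.
    exists l. intros n.
    assert (0 <= rho ^ n)%R by (apply pow_le; lra).
    rewrite Rabs_mult, (Rabs_pos_eq (rho ^ n)) by assumption.
    eapply Rle_trans; [| refine (term_le_series (fun j => gbinom_bound W e j * rho ^ j)%R l n _ Hl)].
    - apply Rmult_le_compat_r; [assumption |].
      eapply Rle_trans; [apply Hu | now apply Cmod_gbinom_le].
    - intros k; simpl. apply Rmult_le_pos; [left; now apply gbinom_bound_pos | apply pow_le; lra]. }
  assert (HA : Rbar_lt x (CV_radius A)) by (apply HCV; intros; apply re_le_Cmod).
  assert (HB : Rbar_lt x (CV_radius B)).
  { apply HCV; intros j. eapply Rle_trans; [| apply Rmax_Cmod]. apply Rmax_r. }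
  assert (Hin : forall t, (0 <= t <= x)%R -> forall u, Rbar_lt x (CV_radius u) -> Rbar_lt (Rabs t) (CV_radius u)).
  { intros t Ht u Hu. apply Rbar_le_lt_trans with x; [| exact Hu].
    simpl. rewrite Rabs_pos_eq; lra. }
  (* [(1 + e t) (p + i q)' = w (p + i q)] *)
  set (p := PSeries A). set (q := PSeries B).
  set (p' := PSeries (PS_derive A)). set (q' := PSeries (PS_derive B)).
  (* Stated for a coupled pair so as to serve both parts: (c, d) is (a, -b) for the real part and
     (a, b) for the imaginary part. *)
  assert (Hgen : forall u v c d, Rbar_lt x (CV_radius u) -> Rbar_lt x (CV_radius v) ->
    (forall n, INR (S n) * u (S n) = c * u n + d * v n - e * (INR n * u n))%R ->
    forall t, (0 <= t <= x)%R ->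
    PSeries (PS_derive u) t = (/ (1 + e * t) * (c * PSeries u t + d * PSeries v t))%R).
  { intros u v c d Hu Hv Hr t Ht.
    assert (Hnz : (1 + e * t <> 0)%R) by nra.
    assert (Hk : (PSeries (PS_derive u) t + e * (t * PSeries (PS_derive u) t)
      = c * PSeries u t + d * PSeries v t)%R).
    { assert (Eu : ex_pseries u t) by (apply CV_radius_inside, Hin; auto).
      assert (Ev : ex_pseries v t) by (apply CV_radius_inside, Hin; auto).
      assert (Ed : ex_pseries (PS_derive u) t) by (apply ex_pseries_derive, Hin; auto).
      rewrite <- PSeries_incr_1, <- !PSeries_scal, <- !PSeries_plus;
        try (apply ex_pseries_scal; [apply Rmult_comm |]); try apply ex_pseries_incr_1; auto.
      apply PSeries_ext. intros n.
      unfold PS_plus, PS_scal, PS_derive, PS_incr_1, plus, scal; simpl; unfold mult; simpl.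
      destruct n as [|n].
      - generalize (Hr 0%nat). simpl. unfold zero; simpl. lra.
      - generalize (Hr (S n)). simpl. lra. }
    apply Rmult_eq_reg_l with (1 + e * t)%R; [| exact Hnz].
    rewrite <- Rmult_assoc, Rinv_r, Rmult_1_l by exact Hnz. rewrite <- Hk. ring. }
  assert (Hp' : forall t, (0 <= t <= x)%R -> p' t = (/ (1 + e * t) * (a * p t - b * q t))%R).
  { intros t Ht. unfold p', p, q. rewrite (Hgen A B a (- b)%R HA HB); [| | exact Ht].
    - ring.
    - intros n; rewrite HrA; ring. }
  assert (Hq' : forall t, (0 <= t <= x)%R -> q' t = (/ (1 + e * t) * (a * q t + b * p t))%R).
  { intros t Ht. unfold q', p, q. apply (Hgen B A a b HB HA); [| exact Ht].
    intros n; rewrite HrB; ring. }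
  assert (Dp : forall t, (0 <= t <= x)%R -> is_derive p t (p' t)).
  { intros t Ht; apply is_derive_PSeries, Hin; auto. }
  assert (Dq : forall t, (0 <= t <= x)%R -> is_derive q t (q' t)).
  { intros t Ht; apply is_derive_PSeries, Hin; auto. }
  (* [U] and [V] are the real and imaginary parts of exp(-w L) (p + i q). *)
  set (U := fun t => (exp (- a * L t) * (p t * cos (b * L t) + q t * sin (b * L t)))%R).
  set (V := fun t => (exp (- a * L t) * (q t * cos (b * L t) - p t * sin (b * L t)))%R).
  assert (DU : forall t, (0 <= t <= x)%R -> is_derive U t 0%R).
  { intros t Ht. unfold U.
    assert (H1 := Dp t Ht). assert (H2 := Dq t Ht). assert (H3 := HL t Ht).
    auto_derive; [repeat split; eexists; eassumption |].
    replace (Derive (fun x0 => p x0) t) with (p' t) by (symmetry; exact (is_derive_unique _ _ _ H1)).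
    replace (Derive (fun x0 => q x0) t) with (q' t) by (symmetry; exact (is_derive_unique _ _ _ H2)).
    replace (Derive (fun x0 => L x0) t) with (/ (1 + e * t))%R
      by (symmetry; exact (is_derive_unique _ _ _ H3)).
    rewrite (Hp' t Ht), (Hq' t Ht). ring. }
  assert (DV : forall t, (0 <= t <= x)%R -> is_derive V t 0%R).
  { intros t Ht. unfold V.
    assert (H1 := Dp t Ht). assert (H2 := Dq t Ht). assert (H3 := HL t Ht).
    auto_derive; [repeat split; eexists; eassumption |].
    replace (Derive (fun x0 => p x0) t) with (p' t) by (symmetry; exact (is_derive_unique _ _ _ H1)).
    replace (Derive (fun x0 => q x0) t) with (q' t) by (symmetry; exact (is_derive_unique _ _ _ H2)).
    replace (Derive (fun x0 => L x0) t) with (/ (1 + e * t))%R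
      by (symmetry; exact (is_derive_unique _ _ _ H3)).
    rewrite (Hp' t Ht), (Hq' t Ht). ring. }
  assert (Hcst : forall G : R -> R, (forall t, (0 <= t <= x)%R -> is_derive G t 0%R) -> G x = G 0%R).
  { intros G HG. destruct (MVT_gen G 0 x (fun _ => 0%R)) as [c [_ Hc]].
    - intros t Ht. apply HG. rewrite Rmin_left, Rmax_right in Ht by lra. lra.
    - intros t Ht. rewrite Rmin_left, Rmax_right in Ht by lra.
      apply continuity_pt_filterlim, (ex_derive_continuous G). eexists; now apply HG.
    - lra. }
  assert (Hp0 : p 0%R = 1%R) by (unfold p; now rewrite PSeries_0).
  assert (Hq0 : q 0%R = 0%R) by (unfold q; now rewrite PSeries_0).
  assert (HU := Hcst U DU). assert (HV := Hcst V DV).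
  unfold U, V in HU, HV. rewrite HL0, Hp0, Hq0, !Rmult_0_r, exp_0, cos_0, sin_0 in HU, HV.
  set (th := (b * L x)%R) in *. set (m := (a * L x)%R).
  replace (- a * L x)%R with (- m)%R in HU, HV by (unfold m; ring).
  rewrite exp_Ropp in HU, HV.
  assert (Hem := exp_pos m). assert (Hsc := sin2_cos2 th). unfold Rsqr in Hsc.
  assert (HU' : (p x * cos th + q x * sin th = exp m)%R).
  { apply Rmult_eq_reg_l with (/ exp m)%R; [| apply Rgt_not_eq, Rinv_0_lt_compat; lra].
    rewrite HU. field. lra. }
  assert (HV' : (q x * cos th - p x * sin th = 0)%R).
  { apply Rmult_eq_reg_l with (/ exp m)%R; [| apply Rgt_not_eq, Rinv_0_lt_compat; lra].
    rewrite HV. ring. }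
  (* The two constancy relations are a rotation applied to (p x, q x); it is inverted by means of
     sin^2 + cos^2 = 1. *)
  assert (Ep : p x = (exp m * cos th)%R).
  { transitivity (p x * (sin th * sin th + cos th * cos th))%R; [rewrite Hsc; ring |].
    rewrite <- HU'. transitivity (p x * cos th * cos th + q x * sin th * cos th
      - sin th * (q x * cos th - p x * sin th))%R; [ring | rewrite HV'; ring]. }
  assert (Eq : q x = (exp m * sin th)%R).
  { transitivity (q x * (sin th * sin th + cos th * cos th))%R; [rewrite Hsc; ring |].
    rewrite <- HU'. transitivity ((p x * cos th + q x * sin th) * sin th
      + cos th * (q x * cos th - p x * sin th))%R; [ring | rewrite HV'; ring]. }
  assert (Ecexp : cexp (w * L x) = (p x, q x)).
  { rewrite Ep, Eq. unfold cexp. now rewrite re_scal_r, im_scal_r. }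
  rewrite Ecexp.
  (* Convergence in [C] comes from the majorant; only then is the limit identified, one coordinate
     at a time. *)
  destruct (ex_Cseries (fun j => gbinom w e j * RtoC x ^ j) (fun j => gbinom_bound W e j * x ^ j)%R)
    as [l Hl]; [| now apply gbinom_bound_ex_series |].
  { intros n. rewrite Cmod_mult, Cmod_pow, Cmod_R, (Rabs_pos_eq x) by exact Hx.
    apply Rmult_le_compat_r; [now apply pow_le | now apply Cmod_gbinom_le]. }
  refine (Cseries_eq _ _ _ _ Hl).
  assert (Hterm : forall j, gbinom w e j * RtoC x ^ j = (A j * x ^ j, B j * x ^ j)%R).
  { intros j. unfold A, B. now rewrite <- re_scal_r, <- im_scal_r, RtoC_pow, <- surjective_pairing. }
  assert (Hsum : forall N, sum_n (fun j => gbinom w e j * RtoC x ^ j) N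
     = (sum_n (fun j => A j * x ^ j)%R N, sum_n (fun j => B j * x ^ j)%R N)).
  { intros N; induction N as [|N IH].
    - now rewrite !sum_O.
    - now rewrite !sum_Sn, IH, Hterm. }
  destruct l as [l1 l2]. f_equal.
  - symmetry. apply is_pseries_unique, is_pseries_R.
    apply (filterlim_ext (fun N => fst (sum_n (fun j => gbinom w e j * RtoC x ^ j) N))).
    { intros N; now rewrite Hsum. }
    eapply (filterlim_comp _ _ _ _ fst _ (locally (l1, l2))); [exact Hl |].
    apply continuous_fst.
  - symmetry. apply is_pseries_unique, is_pseries_R.
    apply (filterlim_ext (fun N => snd (sum_n (fun j => gbinom w e j * RtoC x ^ j) N))).
    { intros N; now rewrite Hsum. }
    eapply (filterlim_comp _ _ _ _ snd _ (locally (l1, l2))); [exact Hl |].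
    apply continuous_snd.
Qed.

Lemma cexp_series (z : C) : Cseries (fun j => gbinom z 0 j) (cexp z).
Proof.
  apply (Cseries_eq _ (cexp (z * RtoC 1))); [f_equal; ring |].
  eapply Cseries_ext; [| apply (gbinom_series z 0 1 (fun t => t))]; try lra.
  - intros n; simpl. rewrite Cpow_1_l. ring.
  - intros t _. replace (/ (1 + 0 * t))%R with 1%R by (field; lra). apply (is_derive_id t).
Qed.

Lemma binomial_series (w : C) (x : R) :
  (0 <= x < 1)%R -> Cseries (fun j => gbinom w 1 j * RtoC x ^ j) (cpow (1 + x) w).
Proof.
  intros Hx. rewrite cpow_cexp.
  apply (gbinom_series w 1 x (fun t => ln (1 + t))); try lra.
  - rewrite Rplus_0_r; apply ln_1.
  - intros t Ht. auto_derive; [lra |]. field; lra.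
Qed.

(** * Meromorphic functions and the identity theorem *)


Lemma gbinom_exp (z : C) (j : nat) : gbinom z 0 j = RtoC (/ INR (fact j)) * z ^ j.
Proof.
  induction j as [|j IH].
  - simpl. rewrite Rinv_1. ring.
  - cbn [gbinom]. rewrite IH, Rmult_0_l, fact_simpl, mult_INR, Rinv_mult, RtoC_mult, Cpow_S. ring.
Qed.

(** Factoring out [cexp (z0 * l)], whose modulus depends on [Re z0] alone, leaves an exponential
    series whose norm is exactly exp(|l| r). *)
Lemma expands_cexp (l : R) (z0 : C) (r : R) :
  (0 <= r)%R -> expands (fun s => cexp (s * l)) z0 r (exp (Re z0 * l + Rabs l * r)).
Proof.
  intros Hr.
  rewrite exp_plus. replace (exp (Re z0 * l)) with (Cmod (cexp (z0 * l)))
    by now rewrite Cmod_cexp, re_scal_r.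
  apply (expands_ext (fun s => cexp (z0 * l) * cexp ((s - z0) * l))).
  { intros h _. rewrite <- cexp_plus. f_equal. ring. }
  apply expands_scal.
  exists (fun j => gbinom l 0 j); split.
  - exists (exp (Rabs l * r)); split; [lra |].
    generalize (is_exp_Reals (Rabs l * r)). intros H. apply is_pseries_R in H.
    eapply is_series_ext; [| exact H]. intros j; simpl.
    rewrite gbinom_exp, Cmod_mult, Cmod_pow, !Cmod_R, Rpow_mult_distr.
    rewrite (Rabs_pos_eq (/ _)); [ring |].
    left; apply Rinv_0_lt_compat, lt_0_INR, lt_O_fact.
  - intros h Hh. eapply Cseries_ext; [| apply cexp_series].
    intros j; simpl. rewrite !gbinom_exp.
    replace ((z0 + h - z0) * l) with (h * l) by ring. rewrite Cpow_mult_l. ring.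
Qed.

Lemma expands_affine (f : C -> C) (a b z0 : C) (r M : R) :
  expands f (a * z0 + b) (Cmod a * r) M -> expands (fun s => f (a * s + b)) z0 r M.
Proof.
  intros [u [[S [HS HS']] Hf]]. exists (fun i => u i * a ^ i); split.
  - exists S; split; [exact HS |]. eapply is_series_ext; [| exact HS'].
    intros i; simpl. rewrite Cmod_mult, Cmod_pow, Rpow_mult_distr. ring.
  - intros h Hh.
    apply (Cseries_eq _ (f (a * z0 + b + a * h))); [f_equal; ring |].
    eapply Cseries_ext; [| apply (Hf (a * h))].
    + intros i; simpl. rewrite Cpow_mult_l. ring.
    + rewrite Cmod_mult. apply Rmult_le_compat_l; [apply Cmod_ge_0 | exact Hh].
Qed.

(** The bound is the maximum of the modulus of x^(c-s) over the disc. This sharpness makes the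
    half-planes of convergence come out right; 1 <= x serves to give |ln x| = ln x. *)
Lemma expands_cpow (x : R) (c z0 : C) (r : R) :
  (1 <= x)%R -> (0 <= r)%R ->
  expands (fun s => cpow x (c - s)) z0 r (Rpower x (Re c - Re z0 + r)).
Proof.
  intros Hx Hr.
  apply (expands_ext (fun s => cexp ((- (1) * s + c) * ln x))).
  { intros h _. rewrite cpow_cexp. f_equal. ring. }
  apply (expands_affine (fun s => cexp (s * ln x))).
  rewrite Cmod_opp, Cmod_1, Rmult_1_l.
  eapply expands_le; [| now apply expands_cexp].
  right. unfold Rpower. f_equal.
  assert (0 <= ln x)%R.
  { destruct (Req_dec x 1) as [-> | Hne]; [rewrite ln_1; lra |].
    rewrite <- ln_1. left; apply ln_increasing; lra. }
  rewrite Rabs_pos_eq by assumption.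
  destruct c as [c1 c2], z0 as [x0 y0]. unfold Re; simpl. ring.
Qed.

Lemma expands_radius (f : C -> C) (z0 : C) (r r' M : R) :
  (0 <= r' <= r)%R -> expands f z0 r M -> expands f z0 r' M.
Proof.
  intros Hr [u [[S [HS HS']] Hf]]. exists u; split.
  - destruct (ex_series_bounded (fun i => Cmod (u i) * r' ^ i)%R S) as [T [HT HT']].
    + intros n; apply Rmult_le_pos; [apply Cmod_ge_0 | apply pow_le; lra].
    + intros n. eapply Rle_trans; [apply (sum_n_le_R _ (fun i => Cmod (u i) * r ^ i)%R) |].
      * intros i. apply Rmult_le_compat_l; [apply Cmod_ge_0 | now apply pow_incr].
      * apply sum_n_le_series; [| exact HS'].
        intros i; apply Rmult_le_pos; [apply Cmod_ge_0 | apply pow_le; lra].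
    + exists T; split; [lra | exact HT'].
  - intros h Hh; apply Hf; lra.
Qed.

(** * Meromorphy expressed by normed expansions *)

Lemma locally'_C (z0 : C) (P : C -> Prop) :
  @locally' C_UniformSpace z0 P <->
  exists d, (0 < d)%R /\ forall h : C, h <> 0 -> (Cmod h <= d)%R -> P (z0 + h).
Proof.
  split.
  - intros [d Hd]. exists (d / 2)%R. assert (H := cond_pos d). split; [lra |].
    intros h Hh Hhd. apply Hd.
    + apply (C_NormedModule_mixin_compat1 z0 (z0 + h) d).
      change (Cmod (z0 + h - z0) < d)%R. replace (z0 + h - z0) with h by ring. lra.
    + intros E. apply Hh. replace h with (z0 + h - z0) by ring. rewrite E. ring.
  - intros [d [Hd H]].
    assert (Hd2 : (0 < d / 2)%R) by lra.
    exists (mkposreal _ Hd2). intros y Hy Hne.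
    apply (C_NormedModule_mixin_compat2 z0 y) in Hy.
    change (Cmod (y - z0) < sqrt 2 * (d / 2))%R in Hy.
    assert (Ey : @eq C (z0 + (y - z0)) y) by ring.
    rewrite <- Ey. apply H.
    + intros E. apply Hne. rewrite <- Ey, E. apply Cplus_0_r.
    + assert (sqrt 2 < 2)%R.
      { rewrite <- (sqrt_square 2) at 2 by lra. apply sqrt_lt_1; lra. }
      left; eapply Rlt_trans; [exact Hy | nra].
Qed.

Lemma pow_n_Cpow (h : C) (i : nat) : @pow_n C_Ring h i = h ^ i.
Proof. induction i as [|i IH]; [reflexivity |]. simpl. now rewrite IH. Qed.

Lemma is_pseries_Cseries (a : nat -> C) (h l : C) :
  @is_pseries C_AbsRing C_NormedModule a h l <-> Cseries (fun i => a i * h ^ i) l.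
Proof.
  split; apply is_series_ext; intros i; rewrite <- pow_n_Cpow; apply Cmult_comm.
Qed.

Lemma Cseries_bounded (u : nat -> C) (l : C) :
  Cseries u l -> exists B, forall n, (Cmod (u n) <= B)%R.
Proof.
  intros H. assert (Hd := Cseries_dist u l H).
  apply is_lim_seq_spec in Hd. destruct (Hd (mkposreal 1 Rlt_0_1)) as [N HN]. simpl in HN.
  assert (Hbig : forall n, (N <= n)%nat -> (Cmod (u (S n)) <= 2)%R).
  { intros n Hn.
    assert (H1 := HN n Hn). assert (H2 := HN (S n) ltac:(lia)).
    rewrite Rminus_0_r, Rabs_pos_eq in H1, H2 by apply Cmod_ge_0.
    rewrite sum_Sn in H2. change (plus (sum_n u n) (u (S n))) with (sum_n u n + u (S n)) in H2.
    replace (u (S n)) with ((l - sum_n u n) + - (l - (sum_n u n + u (S n)))) by ring.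
    eapply Rle_trans; [apply Cmod_triangle |]. rewrite Cmod_opp. lra. }
  assert (Hsmall : forall K, exists B, forall n, (n <= K)%nat -> (Cmod (u n) <= B)%R).
  { induction K as [|K [B HB]].
    - exists (Cmod (u 0%nat)). intros n Hn. replace n with 0%nat by lia. lra.
    - exists (Rmax B (Cmod (u (S K)))). intros n Hn.
      destruct (Nat.eq_dec n (S K)) as [-> | Hne]; [apply Rmax_r |].
      eapply Rle_trans; [apply HB; lia | apply Rmax_l]. }
  destruct (Hsmall N) as [B HB]. exists (Rmax B 2). intros n.
  destruct (Nat.le_gt_cases n N) as [Hn | Hn].
  - eapply Rle_trans; [apply HB, Hn | apply Rmax_l].
  - destruct n as [|n]; [lia |]. eapply Rle_trans; [apply Hbig; lia | apply Rmax_r].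
Qed.

(** Pointwise convergence at h = d bounds the terms there, so at radius d/2 they are dominated by a
    geometric series (Abel's lemma). This supplies the norm bound that [meromorphic_at] does not
    mention. *)
Lemma meromorphic_at_expands (f : C -> C) (z0 : C) :
  meromorphic_at f z0 <->
  exists (N : nat) (r M : R) (g : C -> C), (0 < r)%R /\ expands g z0 r M /\
    forall h : C, h <> 0 -> (Cmod h <= r)%R -> g (z0 + h) = h ^ N * f (z0 + h).
Proof.
  split.
  - intros [N [a Ha]]. apply locally'_C in Ha. destruct Ha as [d [Hd Ha]].
    assert (Hs : forall h : C, h <> 0 -> (Cmod h <= d)%R -> Cseries (fun i => a i * h ^ i) (h ^ N * f (z0 + h))).
    { intros h Hh Hhd. specialize (Ha h Hh Hhd). apply is_pseries_Cseries in Ha.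
      replace (z0 + h - z0) with h in Ha by ring. exact Ha. }
    assert (Hdc : Cmod d = d) by (rewrite Cmod_R; apply Rabs_pos_eq; lra).
    destruct (Cseries_bounded (fun i => a i * RtoC d ^ i) _ (Hs (RtoC d)
      ltac:(intros E; apply RtoC_inj in E; lra) ltac:(lra))) as [B HB].
    assert (HB' : forall n, (Cmod (a n) * (d / 2) ^ n <= B * (/ 2) ^ n)%R).
    { intros n. specialize (HB n). rewrite Cmod_mult, Cmod_pow, Hdc in HB.
      unfold Rdiv. rewrite Rpow_mult_distr, <- Rmult_assoc.
      apply Rmult_le_compat_r; [apply pow_le; lra | exact HB]. }
    assert (Hpos : forall n, (0 <= Cmod (a n) * (d / 2) ^ n)%R).
    { intros n. apply Rmult_le_pos; [apply Cmod_ge_0 | apply pow_le; lra]. }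
    assert (Hgeo : is_series (fun n => B * (/ 2) ^ n)%R (B * / (1 - / 2))%R).
    { apply Rseries_scal, is_series_geom. rewrite Rabs_pos_eq; lra. }
    destruct (ex_series_bounded (fun n => Cmod (a n) * (d / 2) ^ n)%R (B * / (1 - / 2))%R) as [S [HS HS']].
    { exact Hpos. }
    { intros n. eapply Rle_trans; [apply (sum_n_le_R _ _ n HB') |].
      apply (sum_n_le_series (fun n => B * (/ 2) ^ n)%R); [| exact Hgeo].
      intros k. eapply Rle_trans; [apply Hpos | apply HB']. }
    (* At the centre the constant coefficient is the only correct value, since [f z0] is
       arbitrary. *)
    set (g := fun z => if excluded_middle_informative (z = z0) then a 0%nat else (z - z0) ^ N * f z).
    exists N, (d / 2)%R, S, g. split; [lra | split].
    + exists a; split; [exists S; split; [lra | exact HS'] |].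
      intros h Hh. unfold g. destruct (excluded_middle_informative (z0 + h = z0)) as [E | E].
      * assert (h = 0) as -> by (replace h with (z0 + h - z0) by ring; rewrite E; ring).
        apply (Cseries_eq _ (a 0%nat * 0 ^ 0 + 0)); [simpl; ring |].
        apply (Cseries_untail (fun i => a i * 0 ^ i)).
        eapply Cseries_ext; [| apply Cseries_0]. intros n; simpl; ring.
      * replace (z0 + h - z0) with h by ring. apply Hs; [| lra].
        intros ->. apply E. ring.
    + intros h Hh _. unfold g. destruct (excluded_middle_informative (z0 + h = z0)) as [E | E].
      * exfalso. apply Hh. replace h with (z0 + h - z0) by ring. rewrite E. ring.
      * now replace (z0 + h - z0) with h by ring.
  - intros [N [r [M [g [Hr [[a [_ Ha]] Hg]]]]]]. exists N, a.
    apply locally'_C. exists r; split; [exact Hr |]. intros h Hh Hhr.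
    apply is_pseries_Cseries. replace (z0 + h - z0) with h by ring.
    rewrite <- Hg by assumption. now apply Ha.
Qed.

Lemma meromorphic_at_ext (f g : C -> C) (z0 : C) :
  @locally' C_UniformSpace z0 (fun z => f z = g z) -> meromorphic_at f z0 -> meromorphic_at g z0.
Proof.
  intros H [N [a Ha]]. exists N, a.
  generalize (filter_and _ _ H Ha). apply filter_imp.
  intros z [E Hz]. now rewrite <- E.
Qed.

Lemma expands_meromorphic_at (f : C -> C) (z0 : C) (r M : R) :
  (0 < r)%R -> expands f z0 r M -> meromorphic_at f z0.
Proof.
  intros Hr Hf. apply meromorphic_at_expands. exists 0%nat, r, M, f.
  split; [exact Hr | split; [exact Hf |]]. intros; simpl; ring.
Qed.

Lemma meromorphic_at_const (c z0 : C) : meromorphic_at (fun _ => c) z0.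
Proof. apply (expands_meromorphic_at _ z0 1 (Cmod c)); [lra | apply expands_const]. Qed.

Lemma meromorphic_at_mult (f g : C -> C) (z0 : C) :
  meromorphic_at f z0 -> meromorphic_at g z0 -> meromorphic_at (fun s => f s * g s) z0.
Proof.
  intros Hf Hg. apply meromorphic_at_expands in Hf, Hg.
  destruct Hf as [N [r [M [F [Hr [HF Hf]]]]]]. destruct Hg as [N' [r' [M' [G [Hr' [HG Hg]]]]]].
  assert (Hm : (0 < Rmin r r')%R) by now apply Rmin_glb_lt.
  assert (H1 := Rmin_l r r'). assert (H2 := Rmin_r r r').
  apply meromorphic_at_expands.
  exists (N + N')%nat, (Rmin r r'), (M * M')%R, (fun s => F s * G s). split; [exact Hm | split].
  - apply expands_mult; [exact Hm | |]; (eapply expands_radius; [| eassumption]); lra.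
  - intros h Hh Hhr. rewrite Hf, Hg, Cpow_add_r by (assumption || lra). ring.
Qed.

Lemma meromorphic_at_plus (f g : C -> C) (z0 : C) :
  meromorphic_at f z0 -> meromorphic_at g z0 -> meromorphic_at (fun s => f s + g s) z0.
Proof.
  intros Hf Hg. apply meromorphic_at_expands in Hf, Hg.
  destruct Hf as [N [r [M [F [Hr [HF Hf]]]]]]. destruct Hg as [N' [r' [M' [G [Hr' [HG Hg]]]]]].
  assert (Hm : (0 < Rmin r r')%R) by now apply Rmin_glb_lt.
  assert (H1 := Rmin_l r r'). assert (H2 := Rmin_r r r').
  apply meromorphic_at_expands.
  eexists (N + N')%nat, (Rmin r r'), _, (fun s => (s - z0) ^ N' * F s + (s - z0) ^ N * G s).
  split; [exact Hm | split].
  - apply expands_plus; [lra | |]; (apply expands_shift_pow; [lra |]);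
      (eapply expands_radius; [| eassumption]); lra.
  - intros h Hh Hhr. rewrite Hf, Hg, Cpow_add_r by (assumption || lra).
    replace (z0 + h - z0) with h by ring. ring.
Qed.

Lemma meromorphic_at_opp (f : C -> C) (z0 : C) :
  meromorphic_at f z0 -> meromorphic_at (fun s => - f s) z0.
Proof.
  intros Hf. apply (meromorphic_at_ext (fun s => (- (1)) * f s)).
  - apply filter_forall; intros; ring.
  - apply meromorphic_at_mult; [apply meromorphic_at_const | exact Hf].
Qed.

Lemma meromorphic_at_minus (f g : C -> C) (z0 : C) :
  meromorphic_at f z0 -> meromorphic_at g z0 -> meromorphic_at (fun s => f s - g s) z0.
Proof. intros Hf Hg. apply meromorphic_at_plus; [exact Hf | now apply meromorphic_at_opp]. Qed.

Lemma meromorphic_at_affine (f : C -> C) (a b z0 : C) :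
  a <> 0 -> meromorphic_at f (a * z0 + b) -> meromorphic_at (fun s => f (a * s + b)) z0.
Proof.
  intros Ha Hf. apply meromorphic_at_expands in Hf. apply meromorphic_at_expands.
  destruct Hf as [N [r [M [F [Hr [HF Hf]]]]]].
  assert (Hca : (0 < Cmod a)%R) by now apply Cmod_gt_0.
  assert (Hcan : Cmod a <> 0%R) by lra.
  eexists N, (r / Cmod a)%R, _, (fun s => (/ a) ^ N * F (a * s + b)).
  split; [now apply Rdiv_lt_0_compat | split].
  - apply expands_scal, expands_affine. replace (Cmod a * (r / Cmod a))%R with r by (field; lra).
    exact HF.
  - intros h Hh Hhr. replace (a * (z0 + h) + b) with (a * z0 + b + a * h) by ring.
    rewrite Hf.
    + rewrite Cmult_assoc, <- Cpow_mult_l. replace (/ a * (a * h)) with h by (field; exact Ha).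
      reflexivity.
    + now apply Cmult_neq_0.
    + rewrite Cmod_mult. replace r with (Cmod a * (r / Cmod a))%R by (field; lra).
      apply Rmult_le_compat_l; lra.
Qed.

Lemma meromorphic_at_cpow (x : R) (a b z0 : C) :
  a <> 0 -> meromorphic_at (fun s => cpow x (a * s + b)) z0.
Proof.
  intros Ha. apply (meromorphic_at_affine (cpow x)); [exact Ha |].
  eapply (expands_meromorphic_at _ _ 1); [lra |].
  apply (expands_ext (fun s => cexp (s * ln x))).
  { intros h _. now rewrite cpow_cexp. }
  apply expands_cexp; lra.
Qed.

(** * Reciprocals, isolation of zeros and the identity theorem *)

Lemma Cseries_geom (q : C) : (Cmod q < 1)%R -> Cseries (fun i => q ^ i) (/ (1 - q)).
Proof.
  intros Hq.
  assert (Hne : 1 - q <> 0).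
  { intros E. assert (q = 1) as -> by (replace q with (1 - (1 - q)) by ring; rewrite E; ring).
    rewrite Cmod_1 in Hq; lra. }
  apply (Cseries_lim _ (fun n => Cmod (/ (1 - q) * q) * Cmod q ^ n)%R).
  - intros n. right. rewrite <- Cmod_pow, <- Cmod_mult. f_equal.
    induction n as [|n IH].
    + rewrite sum_O. simpl. field. exact Hne.
    + rewrite sum_Sn.
      change (plus (sum_n (fun i => q ^ i) n) (q ^ S n)) with (sum_n (fun i => q ^ i) n + q ^ S n).
      replace (/ (1 - q) - (sum_n (fun i => q ^ i) n + q ^ S n))
        with (/ (1 - q) - sum_n (fun i => q ^ i) n - q ^ S n) by ring.
      rewrite IH, !Cpow_S. field. exact Hne.
  - replace (Finite 0) with (Finite (Cmod (/ (1 - q) * q) * 0))%R by (f_equal; ring).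
    apply is_lim_seq_mult'; [apply is_lim_seq_const |].
    apply is_lim_seq_geom. rewrite Rabs_pos_eq; [exact Hq | apply Cmod_ge_0].
Qed.

Lemma meromorphic_at_inv (c z0 : C) : meromorphic_at (fun s => / (s - c)) z0.
Proof.
  destruct (excluded_middle_informative (z0 = c)) as [-> | Hne].
  - apply meromorphic_at_expands. eexists 1%nat, 1%R, _, (fun _ => RtoC 1).
    split; [lra | split; [apply expands_const |]].
    intros h Hh _. replace (c + h - c) with h by ring. rewrite Cpow_1_r. field. exact Hh.
  - set (d := z0 - c).
    assert (Hd : d <> 0) by now apply Cminus_eq_contra.
    assert (Hcd : (0 < Cmod d)%R) by now apply Cmod_gt_0.
    apply (expands_meromorphic_at _ _ (Cmod d / 2) (/ Cmod d * / (1 - / 2))%R); [lra |].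
    exists (fun i => / d * (- / d) ^ i); split.
    + eexists; split; [apply Rle_refl |].
      eapply is_series_ext; [| apply (Rseries_scal (/ Cmod d)%R (fun i => (/ 2) ^ i)%R), is_series_geom].
      * intros i. rewrite Cmod_mult, Cmod_pow, Cmod_opp, Cmod_inv, Rmult_assoc, <- Rpow_mult_distr by exact Hd.
        f_equal. f_equal. field. lra.
      * rewrite Rabs_pos_eq; lra.
    + intros h Hh.
      assert (Hq : (Cmod (- / d * h) < 1)%R).
      { rewrite Cmod_mult, Cmod_opp, Cmod_inv by exact Hd.
        apply Rle_lt_trans with (/ Cmod d * (Cmod d / 2))%R.
        - apply Rmult_le_compat_l; [left; now apply Rinv_0_lt_compat | exact Hh].
        - replace (/ Cmod d * (Cmod d / 2))%R with (/ 2)%R by (field; lra). lra. }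
      assert (Hdh : d + h <> 0).
      { intros E. apply (Rlt_irrefl (Cmod d)). apply Rle_lt_trans with (Cmod h); [| lra].
        replace d with (- h + (d + h)) by ring. rewrite E, Cplus_0_r, Cmod_opp. lra. }
      apply (Cseries_eq _ (/ d * / (1 - - / d * h))).
      { replace (z0 + h - c) with (d + h) by (unfold d; ring). field. split; [exact Hdh | exact Hd]. }
      eapply Cseries_ext; [| apply (Cseries_scal (/ d)), (Cseries_geom _ Hq)].
      intros i; simpl. rewrite Cpow_mult_l. ring.
Qed.

(** At a small zero h the constant coefficient equals minus the rest of the series, which is of
    order |h|; hence it vanishes. Dividing by h shifts the coefficients, and induction does the
    others. *)
Lemma series_zeros_coef (a : nat -> C) (r : R) :
  (0 < r)%R -> ex_series (fun i => Cmod (a i) * r ^ i)%R ->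
  (forall d, (0 < d)%R -> exists h : C, h <> 0 /\ (Cmod h <= d)%R /\ Cseries (fun i => a i * h ^ i) (RtoC 0)) ->
  forall n, a n = 0.
Proof.
  intros Hr Hex Hz n. revert a Hex Hz.
  assert (Hstep : forall a : nat -> C, ex_series (fun i => Cmod (a i) * r ^ i)%R ->
    (forall d, (0 < d)%R -> exists h : C, h <> 0 /\ (Cmod h <= d)%R /\ Cseries (fun i => a i * h ^ i) (RtoC 0)) ->
    a 0%nat = 0).
  { intros a [S HS] Hz. apply Cmod_eq_0. apply Rle_antisym; [| apply Cmod_ge_0].
    assert (Hpos : forall i, (0 <= Cmod (a i) * r ^ i)%R).
    { intros i; apply Rmult_le_pos; [apply Cmod_ge_0 | apply pow_le; lra]. }
    assert (HS0 : (0 <= S)%R) by (eapply Rle_trans; [apply (Hpos 0%nat) | now apply (term_le_series _ _ 0%nat Hpos)]).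
    apply Rnot_lt_le; intros Hlt.
    (* This radius makes |h|/r at most |a 0| / (2 (S + 1)), so the rest of the series is at most |a
       0| / 2, a contradiction when a 0 is nonzero. *)
    destruct (Hz (Rmin r (r * (Cmod (a 0%nat) / (2 * (S + 1)))))%R) as [h [Hh [Hhd Hser]]].
    { apply Rmin_glb_lt; [exact Hr |]. apply Rmult_lt_0_compat; [exact Hr | apply Rdiv_lt_0_compat; lra]. }
    assert (Hh1 := Rle_trans _ _ _ Hhd (Rmin_l _ _)). assert (Hh2 := Rle_trans _ _ _ Hhd (Rmin_r _ _)).
    apply Cseries_tail in Hser.
    assert (Hle : (Cmod (0 - a 0%nat * h ^ 0) <= (Cmod h / r) * (S - Cmod (a 0%nat) * r ^ 0))%R).
    { refine (Cseries_Cmod_le _ (fun i => Cmod h / r * (Cmod (a (Datatypes.S i)) * r ^ Datatypes.S i))%R _ _ _ Hser _).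
      - intros i. rewrite Cmod_mult, Cmod_pow. simpl pow.
        replace (Cmod h / r * (Cmod (a (Datatypes.S i)) * (r * r ^ i)))%R
          with (Cmod (a (Datatypes.S i)) * (Cmod h * r ^ i))%R by (field; lra).
        apply Rmult_le_compat_l; [apply Cmod_ge_0 |].
        apply Rmult_le_compat_l; [apply Cmod_ge_0 |].
        apply pow_incr; split; [apply Cmod_ge_0 | exact Hh1].
      - apply (Rseries_scal (Cmod h / r)%R (fun i => Cmod (a (Datatypes.S i)) * r ^ Datatypes.S i)%R).
        apply (is_series_ext (fun k => Cmod (a (1 + k)%nat) * r ^ (1 + k))%R); [reflexivity |].
        generalize (is_series_drop _ _ 0 HS). rewrite sum_O. auto. }
    simpl in Hle. replace (0 - a 0%nat * 1) with (- a 0%nat) in Hle by ring. rewrite Cmod_opp in Hle.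
    assert (Hq : (Cmod h / r <= Cmod (a 0%nat) / (2 * (S + 1)))%R).
    { apply Rmult_le_reg_l with r; [exact Hr |]. replace (r * (Cmod h / r))%R with (Cmod h) by (field; lra). exact Hh2. }
    assert (Hq0 : (0 <= Cmod h / r)%R) by (apply Rdiv_le_0_compat; [apply Cmod_ge_0 | exact Hr]).
    assert ((Cmod h / r) * (S - Cmod (a 0%nat) * 1) <= (Cmod (a 0%nat) / (2 * (S + 1))) * (S + 1))%R.
    { apply Rle_trans with ((Cmod h / r) * (S + 1))%R; [apply Rmult_le_compat_l; lra | apply Rmult_le_compat_r; lra]. }
    replace ((Cmod (a 0%nat) / (2 * (S + 1))) * (S + 1))%R with (Cmod (a 0%nat) / 2)%R in H by (field; lra).
    lra. }
  induction n as [|n IH]; intros a Hex Hz; [now apply Hstep |].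
  apply (IH (fun i => a (S i))).
  - apply ex_series_incr_1 in Hex. destruct Hex as [l Hl]. exists (/ r * l)%R.
    eapply is_series_ext; [| apply (Rseries_scal (/ r)%R _ _ Hl)].
    intros i. simpl. field. lra.
  - intros d Hd. destruct (Hz d Hd) as [h [Hh [Hhd Hser]]]. exists h; split; [exact Hh | split; [exact Hhd |]].
    apply Cseries_tail in Hser. rewrite (Hstep a Hex Hz) in Hser.
    apply (Cseries_scal (/ h)) in Hser.
    apply (Cseries_eq _ (/ h * (0 - 0 * h ^ 0))); [simpl; ring |].
    eapply Cseries_ext; [| exact Hser]. intros i; simpl. field. exact Hh.
Qed.

Lemma meromorphic_at_zeros (f : C -> C) (z0 : C) :
  meromorphic_at f z0 ->
  (forall d, (0 < d)%R -> exists h : C, h <> 0 /\ (Cmod h <= d)%R /\ f (z0 + h) = 0) ->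
  exists d, (0 < d)%R /\ forall h : C, h <> 0 -> (Cmod h <= d)%R -> f (z0 + h) = 0.
Proof.
  intros Hf Hz. apply meromorphic_at_expands in Hf.
  destruct Hf as [N [r [M [g [Hr [[a [[S [_ HS]] Ha]] Hg]]]]]].
  assert (Hzero : forall n, a n = 0).
  { apply (series_zeros_coef a r Hr); [now exists S |].
    intros d Hd. destruct (Hz (Rmin d r)) as [h [Hh [Hhd Hfh]]]; [now apply Rmin_glb_lt |].
    assert (Hh1 := Rle_trans _ _ _ Hhd (Rmin_l _ _)). assert (Hh2 := Rle_trans _ _ _ Hhd (Rmin_r _ _)).
    exists h; split; [exact Hh | split; [exact Hh1 |]].
    apply (Cseries_eq _ (g (z0 + h))); [rewrite Hg, Hfh by assumption; ring | now apply Ha]. }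
  exists r; split; [exact Hr |]. intros h Hh Hhr.
  assert (H0 : h ^ N * f (z0 + h) = 0).
  { rewrite <- Hg by assumption. apply (Cseries_unique (fun i => a i * h ^ i)); [now apply Ha |].
    eapply Cseries_ext; [| apply Cseries_0]. intros i; simpl. rewrite Hzero. ring. }
  apply NNPP; intros Hne. revert H0. apply Cmult_neq_0; [now apply Cpow_nz | exact Hne].
Qed.

(** Meromorphy is only needed on a horizontal half-line, so this also applies
    to functions that have been continued to a half-plane only. *)
Lemma identity_theorem (f : C -> C) (z0 : C) (sigma : R) :
  (forall t : R, (0 <= t)%R -> meromorphic_at f (z0 + RtoC t)) ->
  (forall s, (sigma < Re s)%R -> f s = 0) ->
  @locally' C_UniformSpace z0 (fun z => f z = 0).
Proof.
  intros Hf Hs. apply locally'_C. apply NNPP; intros Hnot.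
  (* Connectedness of the half-line: if the set [A] of bad parameters is not empty, its supremum
     leads to a contradiction. *)
  set (P := fun t : R => exists d, (0 < d)%R /\ forall h : C, h <> 0 -> (Cmod h <= d)%R -> f (z0 + RtoC t + h) = 0).
  set (A := fun t : R => (0 <= t)%R /\ ~ P t).
  assert (HRe : forall h, (- Cmod h <= Re h)%R).
  { intros h. generalize (re_le_Cmod h) (Rabs_maj2 (Re h)). lra. }
  destruct (completeness A) as [T [HT1 HT2]].
  (* Beyond this bound the disc of radius 1 lies in the half-plane where [f] vanishes. *)
  - exists (Rabs (sigma - Re z0) + 2)%R. intros t [Ht HP]. apply Rnot_lt_le; intros Hlt. apply HP.
    exists 1%R; split; [lra |]. intros h _ Hh. apply Hs.
    rewrite !re_plus, re_RtoC. generalize (HRe h) (Rle_abs (sigma - Re z0)). lra.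
  - exists 0%R; split; [lra |]. intros [d [Hd H]]. apply Hnot. exists d; split; [exact Hd |].
    intros h Hh Hhd. rewrite <- (H h Hh Hhd). f_equal. ring.
  - assert (HT0 : (0 <= T)%R).
    { apply HT1. split; [lra |]. intros [d [Hd H]]. apply Hnot. exists d; split; [exact Hd |].
      intros h Hh Hhd. rewrite <- (H h Hh Hhd). f_equal. ring. }
    assert (Hgt : forall t, (T < t)%R -> P t).
    { intros t Ht. apply NNPP; intros HP. assert (t <= T)%R; [| lra]. apply HT1; split; [lra | exact HP]. }
    assert (HRt : forall x : R, Cmod x = Rabs x) by apply Cmod_R.
    (* Good points to the right of [T] provide zeros arbitrarily close to [T], so [f] vanishes on a
       whole punctured disc there. *)
    destruct (meromorphic_at_zeros f (z0 + RtoC T) (Hf T HT0)) as [d [Hd Hd']].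
    { intros d Hd. destruct (Hgt (T + d / 2)%R ltac:(lra)) as [d' [Hd' H]].
      set (e := Rmin d' (d / 4)).
      assert (He : (0 < e)%R) by (apply Rmin_glb_lt; lra).
      assert (He1 : (e <= d')%R) by apply Rmin_l. assert (He2 : (e <= d / 4)%R) by apply Rmin_r.
      (* The offset [e] avoids the centre T + d/2 of the punctured disc, where the value of [f] is
         unknown. *)
      exists (RtoC (d / 2 + e)). split; [| split].
      - intros E; apply RtoC_inj in E; lra.
      - rewrite HRt, Rabs_pos_eq; lra.
      - replace (z0 + RtoC T + RtoC (d / 2 + e)) with (z0 + RtoC (T + d / 2) + RtoC e)
          by (rewrite !RtoC_plus; ring).
        apply H; [intros E; apply RtoC_inj in E; lra |]. rewrite HRt, Rabs_pos_eq; lra. }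
    assert (Hub : is_upper_bound A (T - d)).
    { intros t [Ht HP]. apply Rnot_lt_le; intros Hlt. apply HP.
      destruct (Rlt_le_dec T t) as [Htt | Htt]; [now apply Hgt |].
      destruct (Req_dec t T) as [-> | Hne]; [now exists d |].
      (* A disc of radius e/2 about [t] stays inside the disc about [T] and misses the point [T]
         itself. *)
      set (e := Rmin (T - t) (d - (T - t))).
      assert (He : (0 < e)%R) by (apply Rmin_glb_lt; lra).
      assert (He1 : (e <= T - t)%R) by apply Rmin_l. assert (He2 : (e <= d - (T - t))%R) by apply Rmin_r.
      exists (e / 2)%R; split; [lra |]. intros h Hh Hhe.
      replace (z0 + RtoC t + h) with (z0 + RtoC T + (h + RtoC (t - T))) by (rewrite RtoC_minus; ring).
      apply Hd'.
      - intros E. assert (Eh : h = RtoC (T - t)).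
        { replace h with (h + RtoC (t - T) + RtoC (T - t)) by (rewrite !RtoC_minus; ring). rewrite E; ring. }
        rewrite Eh, HRt, Rabs_pos_eq in Hhe by lra. lra.
      - eapply Rle_trans; [apply Cmod_triangle |]. rewrite HRt, Rabs_left1 by lra. lra. }
    apply HT2 in Hub. lra.
Qed.

(** * Continuation of the zeta function *)


Lemma cpow_plus (x : R) (s t : C) : cpow x (s + t) = cpow x s * cpow x t.
Proof. rewrite !cpow_cexp, <- cexp_plus. f_equal. ring. Qed.

Lemma cpow_mult_base (x y : R) (s : C) :
  (0 < x)%R -> (0 < y)%R -> cpow (x * y) s = cpow x s * cpow y s.
Proof.
  intros Hx Hy. rewrite !cpow_cexp, <- cexp_plus, ln_mult, RtoC_plus by assumption.
  f_equal. ring.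
Qed.

Lemma Cmod_cpow (x : R) (s : C) : Cmod (cpow x s) = Rpower x (Re s).
Proof. rewrite cpow_cexp, Cmod_cexp, re_scal_r. reflexivity. Qed.

Lemma cpow_RtoC (x a : R) : cpow x (RtoC a) = RtoC (Rpower x a).
Proof.
  unfold cpow, Rpower, RtoC, Re, Im; simpl. rewrite Rmult_0_l, cos_0, sin_0. f_equal; ring.
Qed.

Lemma cpow_opp_INR (x : R) (j : nat) : (0 < x)%R -> cpow x (- RtoC (INR j)) = RtoC (/ x) ^ j.
Proof.
  intros Hx. rewrite <- RtoC_opp, cpow_RtoC, Rpower_Ropp, Rpower_pow, <- RtoC_pow, pow_inv by exact Hx.
  reflexivity.
Qed.

Lemma Rpower_opp_2 (x : R) : (0 < x)%R -> Rpower x (- (2)) = (/ x ^ 2)%R.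
Proof.
  intros Hx. rewrite Rpower_Ropp. f_equal. now rewrite <- Rpower_pow.
Qed.

Lemma INR_add2_ge (n : nat) : (2 <= INR (n + 2))%R.
Proof. rewrite plus_INR; simpl. generalize (pos_INR n); lra. Qed.

Lemma ex_series_inv_square : ex_series (fun n => / INR (n + 2) ^ 2)%R.
Proof.
  destruct (ex_series_bounded (fun n => / INR (n + 2) ^ 2)%R 1) as [l [_ Hl]]; [| | now exists l].
  - intros n. left. apply Rinv_0_lt_compat, pow_lt. generalize (INR_add2_ge n); lra.
  (* Telescoping comparison: 1 / (x+1)^2 <= 1/x - 1/(x+1). *)
  - intros n. apply Rle_trans with (1 - / INR (n + 2))%R.
    + induction n as [|n IH].
      * rewrite sum_O. simpl. lra.
      * rewrite sum_Sn. apply Rle_trans with (1 - / INR (n + 2) + / INR (S n + 2) ^ 2)%R.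
        { apply Rplus_le_compat_r; exact IH. }
        assert (H := INR_add2_ge n). replace (S n + 2)%nat with (S (n + 2)) by lia. rewrite S_INR.
        set (x := INR (n + 2)) in *.
        apply Rmult_le_reg_r with (x * (x + 1) ^ 2)%R; [apply Rmult_lt_0_compat; [lra | apply pow_lt; lra] |].
        replace ((1 - / x + / (x + 1) ^ 2) * (x * (x + 1) ^ 2))%R with (x * (x + 1) ^ 2 - (x + 1) ^ 2 + x)%R
          by (field; lra).
        replace ((1 - / (x + 1)) * (x * (x + 1) ^ 2))%R with (x * (x + 1) ^ 2 - x * (x + 1))%R
          by (field; lra).
        nra.
    + assert (H := INR_add2_ge n). assert (0 < / INR (n + 2))%R by (apply Rinv_0_lt_compat; lra). lra.
Qed.

(** A total sum, arbitrary where the series diverges, so that a function of [s] can be written down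
    before its domain of convergence is known. *)
Definition Csum (u : nat -> C) : C := epsilon (inhabits (RtoC 0)) (fun l => Cseries u l).

Lemma Csum_correct (u : nat -> C) : (exists l, Cseries u l) -> Cseries u (Csum u).
Proof. intros H. exact (epsilon_spec (inhabits (RtoC 0)) (fun l => Cseries u l) H). Qed.

Lemma expands_Cmod_le (f : C -> C) (z0 h : C) (r M : R) :
  (Cmod h <= r)%R -> expands f z0 r M -> (Cmod (f (z0 + h)%C) <= M)%R.
Proof.
  intros Hh [a [[S [HS HS']] Hf]]. eapply Rle_trans; [| exact HS].
  refine (Cseries_Cmod_le _ _ _ _ _ (Hf h Hh) HS').
  intros i. rewrite Cmod_mult, Cmod_pow. apply Rmult_le_compat_l; [apply Cmod_ge_0 |].
  apply pow_incr; split; [apply Cmod_ge_0 | exact Hh].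
Qed.

Lemma expands_Csum (f : nat -> C -> C) (z0 : C) (r : R) (M : nat -> R) :
  (0 < r)%R -> (forall k, expands (f k) z0 r (M k)) -> ex_series M ->
  (exists L, expands (fun s => Csum (fun k => f k s)) z0 r L) /\
  Cseries (fun k => f k z0) (Csum (fun k => f k z0)).
Proof.
  intros Hr Hf HM. split.
  - destruct HM as [L HL]. exists L.
    apply (expands_series f _ z0 r M L Hr Hf HL). intros h Hh Hex. now apply Csum_correct.
  - apply Csum_correct, (ex_Cseries _ M); [| exact HM]. intros k.
    replace z0 with (z0 + 0) by ring. apply (expands_Cmod_le _ _ _ r); [rewrite Cmod_0; lra | apply Hf].
Qed.

(** With x = n + 2, this is the part beyond j = J of the expansion of (x + 1)^(1-s) in the powers
    x^(1-s-j). *)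
Definition binom_remainder (J n : nat) (s : C) : C :=
  cpow (INR (n + 2) + 1) (1 - s)
  - sum_n (fun j => gbinom (1 - s) 1 j * cpow (INR (n + 2)) (1 - RtoC (INR j) - s)) J.

(** In the term j = J + 1 + i the power of x has norm at most x^(-2-i), by the condition on J. Since
    x >= 2, the factor x^(-i) makes the sum over i converge uniformly in n, and x^(-2) is left for
    the sum over n. *)
Lemma binom_remainder_expands (J : nat) (z0 : C) (r : R) :
  (0 < r)%R -> (2 - INR J - Re z0 + r <= 0)%R ->
  exists K, forall n, expands (binom_remainder J n) z0 r (K * / INR (n + 2) ^ 2).
Proof.
  intros Hr HJ.
  (* A bound for the norm of s |-> 1 - s on the disc. *)
  set (W := (Cmod 1 + (Cmod (- (1)) * (Cmod z0 + r)))%R).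
  assert (HW : (0 < W)%R).
  { unfold W. rewrite Cmod_opp, Cmod_1. generalize (Cmod_ge_0 z0); lra. }
  destruct (gbinom_bound_ex_series W 1 (/ 2)) as [D HD]; try lra.
  apply (is_series_drop _ _ J) in HD.
  set (D' := (D - sum_n (fun j => gbinom_bound W 1 j * (/ 2) ^ j)%R J)%R) in HD.
  (* [D'] is the tail of the majorant series at 1/2; the power of 2 converts its (1/2)^(J+1+i) into
     (1/2)^i. *)
  exists (2 ^ S J * D')%R. intros n.
  set (x := INR (n + 2)). assert (Hx : (2 <= x)%R) by apply INR_add2_ge.
  assert (Hx2 : (0 < / x ^ 2)%R) by (apply Rinv_0_lt_compat, pow_lt; lra).
  apply (expands_series (fun i s => gbinom (1 - s) 1 (S J + i) * cpow x (1 - RtoC (INR (S J + i)) - s))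
    (binom_remainder J n) z0 r
    (fun i => 2 ^ S J * (gbinom_bound W 1 (S J + i) * (/ 2) ^ (S J + i)) * / x ^ 2)%R); [exact Hr | | |].
  - intros i. eapply expands_le; cycle 1.
    + apply expands_mult; [exact Hr | |].
      * apply (expands_gbinom _ _ _ W); [exact Hr | lra |].
        apply (expands_ext (fun s => 1 + (- (1)) * s)); [intros; ring |].
        unfold W. apply expands_plus; [lra | apply (expands_const 1) |].
        apply expands_scal, expands_id; lra.
      * apply expands_cpow; lra.
    + assert (Hp : (Rpower x (Re (1 - RtoC (INR (S J + i))) - Re z0 + r) <= (/ 2) ^ i * / x ^ 2)%R).
      { apply Rle_trans with (Rpower x (- INR i + - (2))).
        - apply Rle_Rpower; [lra |]. unfold Cminus. rewrite re_plus, re_opp, !re_RtoC.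
          replace (S J + i)%nat with (S (J + i)) by lia. rewrite S_INR, plus_INR.
          lra.
        - rewrite Rpower_plus, Rpower_opp_2, Rpower_Ropp, Rpower_pow by lra.
          apply Rmult_le_compat_r; [lra |]. rewrite <- pow_inv. apply pow_incr.
          split; [left; apply Rinv_0_lt_compat; lra | apply Rinv_le_contravar; lra]. }
      assert (Hg : (0 <= gbinom_bound W 1 (S J + i))%R) by (left; apply gbinom_bound_pos; lra).
      eapply Rle_trans; [apply Rmult_le_compat_l; [exact Hg | exact Hp] |].
      right. rewrite pow_add. transitivity ((2 ^ S J * (/ 2) ^ S J) *
        (gbinom_bound W 1 (S J + i) * ((/ 2) ^ i * / x ^ 2)))%R; [| ring].
      rewrite <- Rpow_mult_distr. replace (2 * / 2)%R with 1%R by lra. rewrite pow1. ring.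
  - apply is_series_scal_r, Rseries_scal, HD.
  - intros h Hh _. set (s := z0 + h).
    assert (Hs : Cseries (fun j => gbinom (1 - s) 1 j * cpow x (1 - RtoC (INR j) - s)) (cpow (x + 1) (1 - s))).
    { apply (Cseries_eq _ (cpow x (1 - s) * cpow (1 + / x) (1 - s))).
      - rewrite <- cpow_mult_base; [| lra |].
        + f_equal. field. lra.
        + assert (0 < / x)%R by (apply Rinv_0_lt_compat; lra). lra.
      - eapply Cseries_ext; [| apply Cseries_scal, binomial_series].
        + intros j; simpl.
          replace (1 - RtoC (INR j) - s) with ((1 - s) + - RtoC (INR j)) by ring.
          rewrite cpow_plus, cpow_opp_INR by lra. ring.
        + split; [left; apply Rinv_0_lt_compat; lra |].
          rewrite <- Rinv_1. apply Rinv_lt_contravar; lra. }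
    exact (Cseries_drop _ _ J Hs).
Qed.

Lemma meromorphic_at_eq (f g : C -> C) (z0 : C) :
  (forall s, f s = g s) -> meromorphic_at f z0 -> meromorphic_at g z0.
Proof. intros H. apply meromorphic_at_ext. apply filter_forall. exact H. Qed.

Lemma meromorphic_at_sum_n (f : nat -> C -> C) (z0 : C) (n : nat) :
  (forall i, (i <= n)%nat -> meromorphic_at (f i) z0) -> meromorphic_at (fun s => sum_n (fun i => f i s) n) z0.
Proof.
  induction n as [|n IH]; intros H.
  - apply (meromorphic_at_eq (f 0%nat)); [intros s; now rewrite sum_O | now apply H].
  - apply (meromorphic_at_eq (fun s => sum_n (fun i => f i s) n + f (S n) s)).
    { intros s; now rewrite sum_Sn. }
    apply meromorphic_at_plus; [apply IH; intros; apply H; lia | apply H; lia].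
Qed.

Lemma sum_n_split2 (u : nat -> C) (m : nat) :
  sum_n u (S (S m)) = u 0%nat + u 1%nat + sum_n (fun i => u (S (S i))) m.
Proof.
  induction m as [|m IH].
  - rewrite !sum_Sn, !sum_O. reflexivity.
  - rewrite sum_Sn, IH, sum_Sn. change plus with Cplus. apply eq_sym, Cplus_assoc.
Qed.

Lemma telescoping_series (s : C) : (2 < Re s)%R ->
  Cseries (fun n => cpow (INR (n + 2)) (1 - s) - cpow (INR (n + 2) + 1) (1 - s)) (cpow 2 (1 - s)).
Proof.
  intros Hs.
  assert (Hsum : forall n, sum_n (fun n => cpow (INR (n + 2)) (1 - s) - cpow (INR (n + 2) + 1) (1 - s)) n
    = cpow 2 (1 - s) - cpow (INR (n + 2) + 1) (1 - s)).
  { induction n as [|n IH].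
    - rewrite sum_O. simpl INR. now replace (1 + 1)%R with 2%R by ring.
    - rewrite sum_Sn, IH. change plus with Cplus.
      replace (S n + 2)%nat with (S (n + 2)) by lia. rewrite (S_INR (n + 2)).
      match goal with |- @eq _ ?a ?b => change (@eq C a b) end. ring. }
  apply (Cseries_lim _ (fun n => / INR (n + 1))%R).
  - intros n. rewrite Hsum.
    replace (cpow 2 (1 - s) - (cpow 2 (1 - s) - cpow (INR (n + 2) + 1) (1 - s)))
      with (cpow (INR (n + 2) + 1) (1 - s)) by ring.
    rewrite Cmod_cpow. assert (H := INR_add2_ge n).
    apply Rle_trans with (Rpower (INR (n + 2) + 1) (- (1))).
    + apply Rle_Rpower; [lra |]. unfold Cminus. rewrite re_plus, re_opp, re_RtoC. lra.
    + rewrite Rpower_Ropp, Rpower_1 by lra.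
      replace (n + 2)%nat with (S (n + 1)) in * by lia. rewrite S_INR in *.
      apply Rinv_le_contravar; lra.
  - apply (is_lim_seq_ext (fun n => / INR (S n))%R).
    + intros n. now rewrite Nat.add_1_r.
    + apply (is_lim_seq_incr_1 (fun n => / INR n)%R).
      apply (is_lim_seq_inv INR p_infty); [apply is_lim_seq_INR | discriminate].
Qed.

Lemma Cseries_zeta_tail_ex (s : C) :
  (2 <= Re s)%R -> exists l, Cseries (fun n => cpow (INR (n + 2)) (- s)) l.
Proof.
  intros Hs. apply (ex_Cseries _ (fun n => / INR (n + 2) ^ 2)%R); [| apply ex_series_inv_square].
  intros n. assert (H := INR_add2_ge n). rewrite Cmod_cpow, <- Rpower_opp_2 by lra.
  apply Rle_Rpower; [lra |]. rewrite re_opp. lra.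
Qed.

(** [zeta s - 1], continued to [Re s > 2 - m]. *)
Lemma zeta_half_plane (m : nat) : exists F : C -> C,
  (forall z0, (2 - INR m < Re z0)%R -> meromorphic_at F z0) /\
  (forall s, (2 < Re s)%R -> Cseries (fun n => cpow (INR (n + 2)) (- s)) (F s)).
Proof.
  induction m as [|m [F [HFm HFs]]].
  - exists (fun s => Csum (fun n => cpow (INR (n + 2)) (- s))). split.
    + intros z0 Hz0. simpl in Hz0.
      (* The disc just reaches the line Re s = 2, where the terms are still bounded by
         [/ INR (n + 2) ^ 2]. *)
      set (r := (Re z0 - 2)%R).
      destruct (expands_Csum (fun n s => cpow (INR (n + 2)) (- s)) z0 r (fun n => / INR (n + 2) ^ 2)%R)
        as [[L HL] _]; [unfold r; lra | | apply ex_series_inv_square |].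
      * intros n. assert (H := INR_add2_ge n).
        rewrite <- Rpower_opp_2 by lra.
        apply (expands_ext (fun s => cpow (INR (n + 2)) (0 - s))); [intros h _; f_equal; ring |].
        replace (- (2))%R with (Re 0 - Re z0 + r)%R by (rewrite re_RtoC; unfold r; ring).
        apply expands_cpow; unfold r; lra.
      * apply (expands_meromorphic_at _ z0 r L); [unfold r; lra | exact HL].
    + intros s Hs. apply Csum_correct, Cseries_zeta_tail_ex. lra.
  (* Here J = m + 2 and j = i + 2. The argument s + i + 1 lies at least one unit to the right of s,
     so for Re s > 1 - m it is in the half-plane of the induction hypothesis. *)
  - set (rem := fun s => Csum (fun n => binom_remainder (S (S m)) n s)).
    set (shifts := fun s => sum_n (fun i => gbinom (1 - s) 1 (S (S i)) * F (s + INR (S i))) m).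
    assert (Hrem : forall z0, (1 - INR m < Re z0)%R ->
      meromorphic_at rem z0 /\ Cseries (fun n => binom_remainder (S (S m)) n z0) (rem z0)).
    { intros z0 Hz0. set (r := (Re z0 - (1 - INR m))%R).
      assert (Hr : (0 < r)%R) by (unfold r; lra).
      destruct (binom_remainder_expands (S (S m)) z0 r Hr) as [K HK].
      { rewrite !S_INR. unfold r. lra. }
      destruct (expands_Csum (binom_remainder (S (S m))) z0 r _ Hr HK) as [[L HL] Hs].
      { destruct ex_series_inv_square as [l Hl]. exists (K * l)%R. now apply Rseries_scal. }
      split; [exact (expands_meromorphic_at _ z0 r L Hr HL) | exact Hs]. }
    exists (fun s => / (s - 1) * (cpow 2 (1 - s) + shifts s + rem s)). split.
    + intros z0 Hz0. rewrite S_INR in Hz0.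
      apply meromorphic_at_mult; [apply meromorphic_at_inv |].
      apply meromorphic_at_plus; [apply meromorphic_at_plus |].
      * apply (meromorphic_at_eq (fun s => cpow 2 (- (1) * s + 1))); [intros s; f_equal; ring |].
        apply meromorphic_at_cpow. intros E. apply (f_equal Cmod) in E.
        rewrite Cmod_opp, Cmod_1, Cmod_0 in E. lra.
      * apply meromorphic_at_sum_n. intros i _. apply meromorphic_at_mult.
        -- apply (expands_meromorphic_at _ z0 1 (gbinom_bound (Cmod 1 + Cmod (- (1)) * (Cmod z0 + 1)) 1 (S (S i)))); [lra |].
           apply expands_gbinom; [lra | lra |].
           apply (expands_ext (fun s => 1 + (- (1)) * s)); [intros; ring |].
           apply expands_plus; [lra | apply (expands_const 1) |].
           apply expands_scal, expands_id; lra.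
        -- apply (meromorphic_at_eq (fun s => F (1 * s + INR (S i)))); [intros s; f_equal; ring |].
           apply meromorphic_at_affine; [exact C1_nz |]. apply HFm.
           rewrite Cmult_1_l, re_plus, re_RtoC, S_INR. generalize (pos_INR i); lra.
      * apply Hrem; lra.
    + intros s Hs. assert (Hm := pos_INR m).
      assert (Hs1 : s - 1 <> 0).
      { intros E. apply (f_equal Re) in E. unfold Cminus in E.
        rewrite re_plus, re_opp, !re_RtoC in E. lra. }
      assert (Hshift : Cseries (fun n => sum_n (fun i => gbinom (1 - s) 1 (S (S i)) *
        cpow (INR (n + 2)) (- (s + INR (S i)))) m) (shifts s)).
      { apply (Cseries_sum_n (fun i n => gbinom (1 - s) 1 (S (S i)) * cpow (INR (n + 2)) (- (s + INR (S i))))).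
        intros i. apply Cseries_scal, HFs. rewrite re_plus, re_RtoC, S_INR. generalize (pos_INR i); lra. }
      eapply Cseries_ext; [| apply (Cseries_scal (/ (s - 1)) _ _ (Cseries_plus _ _ _ _
        (Cseries_plus _ _ _ _ (telescoping_series s Hs) Hshift) (proj2 (Hrem s ltac:(lra)))))].
      (* Once j = 0 and j = 1 are split off, the telescoping difference, the shifted terms and the
         remainder add up to s - 1 times the zeta term. *)
      intros n. simpl. unfold binom_remainder. rewrite sum_n_split2.
      rewrite (sum_n_ext (fun i => gbinom (1 - s) 1 (S (S i)) * cpow (INR (n + 2)) (1 - RtoC (INR (S (S i))) - s))
        (fun i => gbinom (1 - s) 1 (S (S i)) * cpow (INR (n + 2)) (- (s + INR (S i))))).
      2:{ intros i. f_equal. f_equal. rewrite (S_INR (S i)), RtoC_plus. ring. }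
      cbn [gbinom]. simpl INR. rewrite Rmult_0_r, Rinv_1.
      replace (1 - RtoC 0 - s) with (1 - s) by ring.
      replace (1 - RtoC 1 - s) with (- s) by ring.
      field. exact Hs1.
Qed.

(** The value at s is taken from a half-plane chosen by Re s. Near a given point only finitely many
    half-planes are involved, and any two of their functions agree on a punctured neighbourhood by
    the identity theorem. *)
Lemma zeta_tail_continuation : exists F : C -> C,
  meromorphic F /\
  (forall s, (2 < Re s)%R -> Cseries (fun n => cpow (INR (n + 2)) (- s)) (F s)).
Proof.
  destruct (choice _ zeta_half_plane) as [G HG].
  assert (HGm := fun m => proj1 (HG m)). assert (HGs := fun m => proj2 (HG m)). clear HG.
  (* The index leaves a margin of 2: every half-plane selected within distance 1 of [z0] still
     contains [z0]. *)
  set (mu := fun x : R => Z.to_nat (up (4 - x))).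
  assert (Hmu : forall x, (2 - INR (mu x) < x - 2)%R).
  { intros x. unfold mu. destruct (archimed (4 - x)) as [H _].
    destruct (Z.le_gt_cases 0 (up (4 - x))) as [Hz | Hz].
    - rewrite INR_IZR_INZ, Z2Nat.id by exact Hz. lra.
    - replace (Z.to_nat (up (4 - x))) with 0%nat by lia. apply IZR_lt in Hz. simpl. lra. }
  assert (Hmono : forall x y, (x <= y)%R -> (mu y <= mu x)%nat).
  { intros x y Hxy. unfold mu. 
    assert (up (4 - y) < up (4 - x) + 1)%Z; [| lia].
    apply lt_IZR. rewrite plus_IZR.
    destruct (archimed (4 - x)) as [H1 _]. destruct (archimed (4 - y)) as [_ H2]. lra. }
  exists (fun s => G (mu (Re s)) s). split; [| intros s Hs; now apply HGs].
  intros z0. apply (meromorphic_at_ext (G (mu (Re z0)))).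
  - assert (Hglue : forall M, @locally' C_UniformSpace z0 (fun s => forall m, (m <= M)%nat ->
      (2 - INR m < Re z0)%R -> G (mu (Re z0)) s = G m s)).
    { assert (Hone : forall m, (2 - INR m < Re z0)%R ->
        @locally' C_UniformSpace z0 (fun s => G (mu (Re z0)) s = G m s)).
      { intros m Hm.
        generalize (identity_theorem (fun s => G (mu (Re z0)) s - G m s) z0 2).
        intros Hid. eapply filter_imp; [| apply Hid].
        - intros s Hs. simpl in Hs.
          replace (G (mu (Re z0)) s) with (G (mu (Re z0)) s - G m s + G m s) by ring.
          rewrite Hs. ring.
        - intros t Ht. apply meromorphic_at_minus; apply HGm; rewrite re_plus, re_RtoC;
            generalize (Hmu (Re z0)); lra.
        - intros s Hs. rewrite (Cseries_unique _ (G (mu (Re z0)) s) (G m s) (HGs _ s Hs) (HGs _ s Hs)). ring. }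
      induction M as [|M IH].
      - destruct (Rlt_dec (2 - INR 0) (Re z0)) as [H | H].
        + eapply filter_imp; [| apply (Hone 0%nat H)].
          intros s Hs m Hm _. now replace m with 0%nat by lia.
        + apply filter_forall. intros s m Hm Hlt. exfalso. apply H. now replace 0%nat with m by lia.
      - destruct (Rlt_dec (2 - INR (S M)) (Re z0)) as [H | H].
        + eapply filter_imp; [| apply (filter_and _ _ IH (Hone (S M) H))].
          intros s [H1 H2] m Hm Hlt. destruct (Nat.eq_dec m (S M)) as [-> | Hne]; [exact H2 |].
          apply H1; [lia | exact Hlt].
        + eapply filter_imp; [| apply IH]. intros s H1 m Hm Hlt.
          apply H1; [| exact Hlt]. destruct (Nat.eq_dec m (S M)) as [-> | Hne]; [contradiction | lia]. }
    (* As [mu] is nonincreasing, this index bounds all those selected in the disc of radius 1. *)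
    specialize (Hglue (mu (Re z0 - 1)%R)). apply locally'_C in Hglue. apply locally'_C.
    destruct Hglue as [d [Hd H]]. exists (Rmin d 1). split; [apply Rmin_glb_lt; lra |].
    intros h Hh Hhd.
    assert (Hh1 := Rle_trans _ _ _ Hhd (Rmin_l _ _)). assert (Hh2 := Rle_trans _ _ _ Hhd (Rmin_r _ _)).
    assert (Hre : (- 1 <= Re h <= 1)%R).
    { generalize (re_le_Cmod h) (Rle_abs (Re h)) (Rabs_maj2 (Re h)). lra. }
    apply H; [exact Hh | exact Hh1 | |].
    + apply Hmono. rewrite re_plus. lra.
    + generalize (Hmu (Re (z0 + h))). rewrite re_plus. lra.
  - apply HGm. generalize (Hmu (Re z0)). lra.
Qed.

(** * Zeta functions of spheres *)


Lemma continuation_unique (u : nat -> C -> C) (F G : C -> C) :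
  is_continuation u F -> is_continuation u G -> meromorphic_eq F G.
Proof.
  intros [HF [a Ha]] [HG [b Hb]] z0.
  generalize (identity_theorem (fun s => F s - G s) z0 (Rmax a b)). intros Hid.
  eapply filter_imp; [| apply Hid].
  - intros s Hs. simpl in Hs. replace (F s) with (F s - G s + G s) by ring. rewrite Hs. ring.
  - intros t _. apply meromorphic_at_minus; auto.
  - intros s Hs. rewrite (Cseries_unique (fun k => u (S k) s) (F s) (G s)); [ring | |].
    + apply Ha. eapply Rle_lt_trans; [apply Rmax_l | exact Hs].
    + apply Hb. eapply Rle_lt_trans; [apply Rmax_r | exact Hs].
Qed.

(** An explicit [F] only witnesses existence; the epsilon choice may be a different
    representative. *)
Lemma continuation_correct (u : nat -> C -> C) (F : C -> C) :
  is_continuation u F -> is_continuation u (continuation u).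
Proof.
  intros H. exact (epsilon_spec (inhabits (fun _ : C => RtoC 0)) (is_continuation u) (ex_intro _ F H)).
Qed.

Lemma continuation_eq (u : nat -> C -> C) (F : C -> C) :
  is_continuation u F -> meromorphic_eq (continuation u) F.
Proof. intros H. apply (continuation_unique u); [exact (continuation_correct u F H) | exact H]. Qed.

Lemma cpow_1_l (s : C) : cpow 1 s = 1.
Proof. rewrite cpow_cexp, ln_1, Cmult_0_r. apply cexp_0. Qed.

Lemma cpow_inv_base (x : R) (s : C) : (0 < x)%R -> cpow (/ x) s = cpow x (- s).
Proof. intros Hx. rewrite !cpow_cexp, ln_Rinv, RtoC_opp by exact Hx. f_equal. ring. Qed.

Lemma RtoC_neq_0 (x : R) : x <> 0%R -> RtoC x <> 0.
Proof. intros H E. now apply H, RtoC_inj. Qed.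

Lemma riemann_zeta_continuation :
  is_continuation (fun k s => cpow (INR k) (- s)) riemann_zeta.
Proof.
  destruct zeta_tail_continuation as [F [HF HFs]].
  apply (continuation_correct _ (fun s => 1 + F s)). split.
  - intros z0. apply meromorphic_at_plus; [apply meromorphic_at_const | apply HF].
  - exists 2%R. intros s Hs.
    apply (Cseries_eq _ (cpow (INR 1) (- s) + F s)); [simpl INR; now rewrite cpow_1_l |].
    apply (Cseries_untail (fun k => cpow (INR (S k)) (- s))).
    eapply Cseries_ext; [| apply (HFs s Hs)]. intros n. simpl. now replace (n + 2)%nat with (S (S n)) by lia.
Qed.

(** Convertible with the summand of [sphere_zeta], so facts about [continuation (sphere_term n)]
    apply to [sphere_zeta n] as they stand. *)
Definition sphere_term (n k : nat) (s : C) : C :=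
  RtoC (sphere_mult n k) * cpow (INR k + (INR n - 1) / 2) (- (2 * s)).

(** For k >= 1 the multiplicity is 2k (k-1)! / k! = 2, and the base is k. *)
Lemma sphere1_continuation :
  is_continuation (sphere_term 1) (fun s => 2 * riemann_zeta (2 * s)).
Proof.
  destruct riemann_zeta_continuation as [HZ [a Ha]]. split.
  - intros z0. apply meromorphic_at_mult; [apply meromorphic_at_const |].
    apply (meromorphic_at_eq (fun s => riemann_zeta (2 * s + 0))); [intros s; f_equal; ring |].
    apply meromorphic_at_affine; [apply RtoC_neq_0; lra | apply HZ].
  - exists (a / 2)%R. intros s Hs.
    assert (Hs2 : (a < Re (2 * s))%R) by (rewrite re_scal_l; lra).
    eapply Cseries_ext; [| apply (Cseries_scal 2 _ _ (Ha _ Hs2))].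
    intros k. unfold sphere_term. f_equal.
    + f_equal. unfold sphere_mult.
      replace (S k + 1 - 2)%nat with k by lia. replace (1 - 1)%nat with 0%nat by lia.
      rewrite fact_simpl, mult_INR. simpl (INR (fact 0)). simpl (INR 1).
      assert (H1 := INR_fact_neq_0 k). assert (H2 : INR (S k) <> 0%R) by (apply not_0_INR; lia).
      field. split; assumption.
    + f_equal. simpl (INR 1). field.
Qed.

(** The partial sums of the grouped series form a subsequence of the original ones, so no absolute
    convergence is needed. *)
Lemma Cseries_pairs (u : nat -> C) (l : C) :
  Cseries u l -> Cseries (fun j => u (2 * j)%nat + u (2 * j + 1)%nat) l.
Proof.
  intros H.
  apply (filterlim_ext (fun N => sum_n u (2 * N + 1))).
  - intros N; induction N as [|N IH].
    + simpl Nat.add. now rewrite sum_Sn, !sum_O.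
    + replace (2 * S N + 1)%nat with (S (S (2 * N + 1))) by lia.
      rewrite !sum_Sn, IH. replace (2 * S N)%nat with (S (2 * N + 1)) by lia.
      replace (S (2 * N + 1) + 1)%nat with (S (S (2 * N + 1))) by lia.
      apply eq_sym, Cplus_assoc.
  - eapply (filterlim_comp _ _ _ (fun N => 2 * N + 1)%nat (sum_n u)); [| exact H].
    apply eventually_subseq. intros n; lia.
Qed.

(** The multiplicity is 2k + 1 and the base (2k + 1)/2, so the terms are 4^s (2k+1)^(-w) with w = 2s
    - 1: the series is 4^s times the odd part of zeta(w) without its first term. *)
Lemma sphere2_continuation :
  is_continuation (sphere_term 2) (fun s => (cpow 4 s - 2) * riemann_zeta (2 * s - 1) - cpow 4 s).
Proof.
  destruct riemann_zeta_continuation as [HZ [a Ha]].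
  assert (H2 : RtoC 2 <> 0) by (apply RtoC_neq_0; lra). split.
  - assert (H4 : forall z0, meromorphic_at (cpow 4) z0).
    { intros z0. apply (meromorphic_at_eq (fun s => cpow 4 (1 * s + 0))); [intros s; f_equal; ring |].
      apply meromorphic_at_cpow, C1_nz. }
    intros z0. apply meromorphic_at_minus; [apply meromorphic_at_mult |].
    + apply meromorphic_at_minus; [apply H4 | apply meromorphic_at_const].
    + apply (meromorphic_at_affine riemann_zeta 2 (- (1))); [exact H2 | apply HZ].
    + apply H4.
  - exists ((a + 1) / 2)%R. intros s Hs. set (w := 2 * s - 1).
    assert (Hw : (a < Re w)%R).
    { unfold w, Cminus. rewrite re_plus, re_opp, re_scal_l, re_RtoC. lra. }
    assert (Hz := Ha w Hw). simpl in Hz.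
    set (u := fun n => cpow (INR (S n)) (- w)).
    (* [u] starts at index 0 with base 1, so even indices carry the odd integers; the even integers
       contribute 2^(-w) zeta(w). *)
    assert (Hodd : Cseries (fun j => u (2 * j)%nat) (riemann_zeta w - cpow 2 (- w) * riemann_zeta w)).
    { eapply Cseries_ext; [| apply (Cseries_minus _ _ _ _ (Cseries_pairs u _ Hz) (Cseries_scal (cpow 2 (- w)) _ _ Hz))].
      intros j. simpl. assert (E : u (2 * j + 1)%nat = cpow 2 (- w) * u j).
      { unfold u. replace (S (2 * j + 1)) with (2 * S j)%nat by lia.
        rewrite mult_INR, cpow_mult_base; [simpl (INR 2); reflexivity | simpl; lra | apply lt_0_INR; lia]. }
      simpl in E. rewrite E. change (cpow match j with O => 1%R | S _ => (INR j + 1)%R end (- w)) with (u j). ring. }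
    (* The sphere series begins at k = 1, that is at the integer 3; dropping the integer 1 produces
       the term -4^s. *)
    apply Cseries_tail in Hodd. apply (Cseries_scal (cpow 4 s)) in Hodd.
    refine (Cseries_eq _ _ _ _ (Cseries_ext _ _ _ _ Hodd)).
    + unfold u. simpl INR. rewrite cpow_1_l.
      assert (E : cpow 4 s * cpow 2 (- w) = 2).
      { replace 4%R with (2 * 2)%R by ring. rewrite cpow_mult_base, <- !cpow_plus by lra.
        replace (s + s + - w) with (RtoC 1) by (unfold w; ring).
        rewrite cpow_RtoC, Rpower_1 by lra. reflexivity. }
      transitivity ((cpow 4 s - cpow 4 s * cpow 2 (- w)) * riemann_zeta w - cpow 4 s); [ring |].
      now rewrite E.
    + intros j. unfold u, sphere_term.
      set (x := INR (S (2 * S j))).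
      assert (Hxe : x = (2 * INR (S j) + 1)%R).
      { unfold x. rewrite S_INR, mult_INR. simpl (INR 2). ring. }
      assert (Hx : (0 < x)%R) by (apply lt_0_INR; lia).
      replace (sphere_mult 2 (S j)) with x.
      * replace (INR (S j) + (INR 2 - 1) / 2)%R with (x * / 2)%R by (rewrite Hxe; simpl (INR 2); field).
        rewrite cpow_mult_base, cpow_inv_base by lra.
        replace (- w) with (RtoC 1 + - (2 * s)) by (unfold w; ring).
        rewrite cpow_plus, cpow_RtoC, Rpower_1 by exact Hx.
        replace 4%R with (2 * 2)%R by ring. rewrite cpow_mult_base, <- cpow_plus by lra.
        replace (- - (2 * s)) with (s + s) by ring. ring.
      * rewrite Hxe. unfold sphere_mult. replace (S j + 2 - 2)%nat with (S j) by lia.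
        replace (2 - 1)%nat with 1%nat by lia. simpl (INR 2). simpl (INR (fact 1)).
        field. apply INR_fact_neq_0.
Qed.

(** Both multiplicities contain the same linear factor 2k + n + 1, so only quotients of factorials
    remain. The case k = 0 is included, as the recursion needs it. *)
Lemma sphere_mult_step (n k : nat) : (1 <= n)%nat ->
  (sphere_mult (n + 2) k =
     sphere_mult n (S k) * ((INR k + 1) * (INR k + INR n)) / (INR n * (INR n + 1)))%R.
Proof.
  intros Hn. destruct n as [|p]; [lia |]. unfold sphere_mult.
  replace (k + (S p + 2) - 2)%nat with (S (k + p)) by lia.
  replace (S k + S p - 2)%nat with (k + p)%nat by lia.
  replace (S p + 2 - 1)%nat with (S (S p)) by lia. replace (S p - 1)%nat with p by lia.
  rewrite !fact_simpl, !mult_INR, plus_INR, !S_INR, plus_INR. simpl (INR 0).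
  assert (H1 := INR_fact_neq_0 k). assert (H2 := INR_fact_neq_0 p).
  assert (H3 := pos_INR k). assert (H4 := pos_INR p).
  field. repeat split; lra.
Qed.

(** Dimension n at index k + 1 and dimension n + 2 at index k share the base y = k + (n+1)/2, and a
    factor y^2 is absorbed by replacing s with s - 1. *)
Lemma sphere_term_step (n k : nat) (s : C) : (1 <= n)%nat ->
  sphere_term (n + 2) k s =
    (sphere_term n (S k) (s - 1) - RtoC (((INR n - 1) / 2) ^ 2) * sphere_term n (S k) s)
      / RtoC (INR n * (INR n + 1)).
Proof.
  intros Hn. assert (HnR : (1 <= INR n)%R) by (apply (le_INR 1); exact Hn).
  assert (Hk := pos_INR k).
  unfold sphere_term. rewrite (sphere_mult_step n k Hn).
  set (y := (INR (S k) + (INR n - 1) / 2)%R).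
  assert (Hy : (0 < y)%R) by (unfold y; rewrite S_INR; lra).
  replace (INR k + (INR (n + 2) - 1) / 2)%R with y
    by (unfold y; rewrite S_INR, plus_INR; simpl (INR 2); field).
  replace (- (2 * (s - 1))) with (RtoC 2 + - (2 * s)) by ring.
  rewrite cpow_plus, cpow_RtoC.
  replace (Rpower y 2) with (y ^ 2)%R by (rewrite <- Rpower_pow by exact Hy; reflexivity).
  assert (Hd : (INR n * (INR n + 1) <> 0)%R) by nra.
  set (d := (INR n * (INR n + 1))%R) in *.
  replace ((INR k + 1) * (INR k + INR n))%R with (y ^ 2 - ((INR n - 1) / 2) ^ 2)%R
    by (unfold y; rewrite S_INR; field).
  rewrite RtoC_div, RtoC_mult, RtoC_minus by exact Hd. field.
  now apply RtoC_neq_0.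
Qed.

(** Because of the index shift, the series of dimension n from k = 1 yields that of dimension n + 2
    from k = 0. The surplus k = 0 term has multiplicity 1 and base (n+1)/2, hence the subtracted
    power. *)
Lemma sphere_step_continuation (n : nat) (F : C -> C) : (1 <= n)%nat ->
  is_continuation (sphere_term n) F ->
  is_continuation (sphere_term (n + 2)) (fun s =>
    (F (s - 1) - RtoC (((INR n - 1) / 2) ^ 2) * F s) / RtoC (INR n * (INR n + 1))
    - cpow (2 / (INR n + 1)) (2 * s)).
Proof.
  intros Hn [HF [a Ha]].
  assert (HnR : (1 <= INR n)%R) by (apply (le_INR 1); exact Hn).
  assert (Hd : RtoC (INR n * (INR n + 1)) <> 0) by (apply RtoC_neq_0; nra).
  split.
  - intros z0. apply meromorphic_at_minus; [apply meromorphic_at_mult; [| apply meromorphic_at_const] |].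
    + apply meromorphic_at_minus.
      * apply (meromorphic_at_eq (fun s => F (1 * s + - (1)))); [intros s; f_equal; ring |].
        apply meromorphic_at_affine; [exact C1_nz | apply HF].
      * apply meromorphic_at_mult; [apply meromorphic_at_const | apply HF].
    + apply (meromorphic_at_eq (fun s => cpow (2 / (INR n + 1)) (2 * s + 0))); [intros s; f_equal; ring |].
      apply meromorphic_at_cpow, RtoC_neq_0; lra.
  (* The extra 1 makes the series converge at s - 1 as well as at s. *)
  - exists (a + 1)%R. intros s Hs.
    assert (H1 : (a < Re (s - 1))%R) by (unfold Cminus; rewrite re_plus, re_opp, re_RtoC; lra).
    assert (H2 : (a < Re s)%R) by lra.
    set (c := RtoC (((INR n - 1) / 2) ^ 2)). set (d := RtoC (INR n * (INR n + 1))) in *.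
    assert (Hser := Cseries_scal (/ d) _ _
      (Cseries_minus _ _ _ _ (Ha _ H1) (Cseries_scal c _ _ (Ha _ H2)))).
    apply Cseries_tail in Hser.
    refine (Cseries_eq _ _ _ _ (Cseries_ext _ _ _ _ Hser)).
    + assert (E : / d * (sphere_term n 1 (s - 1) - c * sphere_term n 1 s) = sphere_term (n + 2) 0 s).
      { rewrite sphere_term_step by exact Hn. fold c d. field. exact Hd. }
      assert (E' : sphere_term (n + 2) 0 s = cpow (2 / (INR n + 1)) (2 * s)).
      { unfold sphere_term. rewrite sphere_mult_step by exact Hn.
        replace (INR 0 + (INR (n + 2) - 1) / 2)%R with (/ (2 / (INR n + 1)))%R
          by (rewrite plus_INR; simpl; field; lra).
        rewrite cpow_inv_base by (apply Rdiv_lt_0_compat; lra).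
        replace (- - (2 * s)) with (2 * s) by ring.
        replace (sphere_mult n 1) with (INR n + 1)%R.
        - replace ((INR n + 1) * ((INR 0 + 1) * (INR 0 + INR n)) / (INR n * (INR n + 1)))%R with 1%R
            by (simpl; field; lra). ring.
        - unfold sphere_mult. destruct n as [|p]; [lia |].
          replace (1 + S p - 2)%nat with p by lia. replace (S p - 1)%nat with p by lia.
          rewrite !S_INR. simpl (INR (fact 1)). simpl (INR 0).
          assert (H := INR_fact_neq_0 p). field. exact H. }
      simpl in E |- *. rewrite E, E'. field. exact Hd.
    + intros k. simpl. rewrite sphere_term_step by exact Hn. fold c d. field. exact Hd.
Qed.

(** The recursion advances the dimension by two, so the induction carries two consecutive
    dimensions, starting from the circle and the 2-sphere. *)
Lemma sphere_zeta_continuation (n : nat) : (1 <= n)%nat ->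
  is_continuation (sphere_term n) (sphere_zeta n).
Proof.
  intros Hn. assert (H : forall m, is_continuation (sphere_term (S m)) (sphere_zeta (S m)) /\
    is_continuation (sphere_term (S (S m))) (sphere_zeta (S (S m)))).
  { induction m as [|m [IH1 IH2]].
    - split; [exact (continuation_correct _ _ sphere1_continuation)
             | exact (continuation_correct _ _ sphere2_continuation)].
    - split; [exact IH2 |].
      assert (H := sphere_step_continuation (S m) _ ltac:(lia) IH1).
      replace (S m + 2)%nat with (S (S (S m))) in H by lia.
      exact (continuation_correct _ _ H). }
  destruct n as [|m]; [lia | exact (proj1 (H m))].
Qed.

Theorem lemma2p3 :
  (forall n : nat, (1 <= n)%nat ->
     meromorphic_eq (sphere_zeta (n + 2))
       (fun s : C =>
          (sphere_zeta n (s - 1)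
             - RtoC (((INR n - 1) / 2) ^ 2) * sphere_zeta n s)
            / RtoC (INR n * (INR n + 1))
          - cpow (2 / (INR n + 1)) (2 * s))) /\
  meromorphic_eq (sphere_zeta 1) (fun s : C => 2 * riemann_zeta (2 * s)) /\
  meromorphic_eq (sphere_zeta 2)
    (fun s : C => (cpow 4 s - 2) * riemann_zeta (2 * s - 1) - cpow 4 s).
Proof.
  split; [| split].
  - intros n Hn. apply continuation_eq, sphere_step_continuation; [exact Hn |].
    now apply sphere_zeta_continuation.
  - apply continuation_eq, sphere1_continuation.
  - apply continuation_eq, sphere2_continuation.
Qed.
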